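(* Let $m$ be a non-zero cube-free integer and let $C$ be the elliptic curve $U^3+V^3=mW^3$ with identity $(-1,1,0)$. Let $R\in C(\mathbb{Q})$ be a non-torsion rational point, and for $n\ge 1$ write $nR=(U_n,V_n,W_n)$ with $U_n,V_n,W_n\in\mathbb{Z}$ and $\gcd(U_n,V_n,W_n)=1$. Then for all $n>1$, the term $W_n$ has a primitive divisor.
   Context: $C(\mathbb{Q})$ is the set of projective rational points of $U^3+V^3=mW^3$, made into a group by the usual chord and tangent addition; the identity is $(-1,1,0)$ and the inverse of $(U,V,W)$ is $(V,U,W)$. The coordinates $(U_n,V_n,W_n)$ in lowest terms are determined up to a common sign, which plays no role. Primitive divisor: for a sequence $(A_n)_{n\ge1}$ of integers, an integer $d>1$ is a primitive divisor of $A_n$ if $d\mid A_n$ and $\gcd(d,A_k)=1$ for all non-zero terms $A_k$ with $k<n$. *)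

(* Defs.v *)
From HB Require Import structures.
From mathcomp Require Import all_boot all_order all_algebra.

Set Implicit Arguments.
Unset Strict Implicit.
Unset Printing Implicit Defensive.

Import Order.TTheory GRing.Theory Num.Theory.
Local Open Scope ring_scope.

Definition cube_free (m : int) : Prop :=
  forall p : nat, prime p -> ~~ (p ^ 3 %| `|m|)%N.

(* A point of the projective plane over rat is given by a non-zero row vector;
   two vectors represent the same point iff they span the same line of rat^3,
   i.e. iff (P == Q)%MS. *)
Definition coords (u v w : rat) : 'rV[rat]_3 := \row_i [:: u; v; w]`_i.

Definition cubic (m : int) (P : 'rV[rat]_3) : rat :=
  P 0 0 ^+ 3 + P 0 1 ^+ 3 - m%:~R * P 0 2%:R ^+ 3.

Definition on_curve (m : int) (P : 'rV[rat]_3) : Prop :=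
  P != 0 /\ cubic m P = 0.

Definition identity_pt : 'rV[rat]_3 := coords (-1) 1 0.

(* The linear form in x that vanishes exactly at the point p of the projective
   line. *)
Definition bracket (p x : 'rV[rat]_2) : rat := p 0 0 * x 0 1 - p 0 1 * x 0 0.

(* Some projective line meets the curve exactly in P, Q and S, counted with
   multiplicity.  The line is parametrised by x |-> x *m L, and the binary
   cubic form obtained by restricting the equation of the curve to it has the
   parameters p, q, r of P, Q, S as its roots, with multiplicity: if P = Q the
   line is therefore the tangent at P. *)
Definition line_section (m : int) (P Q S : 'rV[rat]_3) : Prop :=
  exists (L : 'M[rat]_(2, 3)) (p q r : 'rV[rat]_2) (c : rat),
    [/\ row_free L,
        [/\ p != 0, q != 0, r != 0 & c != 0],
        [/\ P = p *m L, Q = q *m L & S = r *m L]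
      & forall x : 'rV[rat]_2,
          cubic m (x *m L) = c * (bracket p x * bracket q x * bracket r x)].

(* T represents P + Q for the chord and tangent law with neutral element
   identity_pt: T is the third point of the line through identity_pt and S,
   where S is the third point of the line through P and Q. *)
Definition is_sum (m : int) (P Q T : 'rV[rat]_3) : Prop :=
  exists2 S, line_section m P Q S & line_section m identity_pt S T.

(* P represents nR = R + ... + R. *)
Fixpoint is_multiple (m : int) (R : 'rV[rat]_3) (n : nat) (P : 'rV[rat]_3) :
    Prop :=
  if n is n'.+1 then exists2 Q, is_multiple m R n' Q & is_sum m Q R P
  else (P == identity_pt)%MS.

Definition torsion (m : int) (R : 'rV[rat]_3) : Prop :=
  exists2 n : nat, (0 < n)%N & is_multiple m R n identity_pt.

(* The sequence is A 1, A 2, ...; the value A 0 is ignored. *)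
Definition primitive_divisor (A : nat -> int) (n : nat) (d : int) : Prop :=
  [/\ 1 < d, (d %| A n)%Z
    & forall k : nat, (1 <= k < n)%N -> A k != 0 -> gcdz d (A k) = 1].

(* Main.v *)
(* Write n R = (U_n, V_n, W_n) and H_n = max(|U_n|, |V_n|); cube-freeness of m
   makes U_n and V_n coprime.

   For a prime p, the n with p | W_n form a subgroup of Z, and if p | W_k then
   v_p(W_{q k}) <= v_p(W_k) + v_p(q) for every prime q.  So if W_n has no
   primitive divisor, every prime of W_n already divides some W_{n/q}, and W_n
   divides the product of the q W_{n/q} over the primes q | n.

   Since U_n + V_n is a non-zero integer, |m W_n^3| lies between (3/4) H_n^2 and
   2 H_n^3.  Hence (3/4) H_n^2 <= prod_q 2 q^3 H_{n/q}^3, where m has cancelled.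

   The duplication formula loses at most a common factor 3, so H_{2 n} lies
   between H_n^4 / 4 and 3 H_n^4.  Together with a parallelogram inequality whose
   error depends on m only, this gives ln H_n = n^2 h up to a small absolute
   constant.  As sum_q 1/q^2 <= 35/72 < 2/3 and h >= (7/12) ln 2, this is a
   contradiction for n >= 4; for n = 3 one also uses the exact value of H_1 when
   H_1 = 2, and n = 2 is direct. *)
Require Import Defs.
From HB Require Import structures.
From mathcomp Require Import all_boot all_order all_algebra.
From mathcomp Require Import ring lra zify.
From mathcomp Require Import boolp classical_sets reals topology normedtype.
From mathcomp Require Import sequences exp Rstruct.

Set Implicit Arguments.
Unset Strict Implicit.
Unset Printing Implicit Defensive.

Import Order.TTheory GRing.Theory Num.Theory.
Import numFieldNormedType.Exports.
Local Open Scope ring_scope.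

(** * The chord and tangent formulas *)

(** All final constants must be free of m. The first two coordinates of the doubling formula are
    forms in u and v alone, so its error terms are absolute; m enters only the parallelogram error,
    which disappears in the limit defining h. The threshold 2/3 is a ratio of exponents: the lower
    bound for |m W_n^3| is quadratic in H_n and the upper bound is cubic, so 2 n^2 h is played
    against 3 n^2 h times the sum of the 1/q^2. No general group law is established. The addition
    formulas may return the zero vector, so identities between them are stated up to proportionality
    and for non-zero vectors. A multiple with W = 0 would be the identity; hence non-torsion makes
    every W_n non-zero, and this single fact excludes all degenerate cases. Valuations are bounded
    by following (U, V, W) modulo powers of p instead of using a formal group. This treats p = 3,
    where the formulas can lose a common factor, like any other prime. *)

Section ChordTangent.

Variable K : realDomainType.
Implicit Types (P Q X Y Z : K * K * K) (a b c m : K).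

Definition scale a P : K * K * K := (a * P.1.1, a * P.1.2, a * P.2).

(** Two non-zero multipliers instead of a quotient, so that the same relation serves over [int] and
    over [rat]. *)
Definition proportional P Q : Prop :=
  exists a b, [/\ a != 0, b != 0 & scale a P = scale b Q].

Definition on_cubic m P : Prop := P.1.1 ^+ 3 + P.1.2 ^+ 3 = m * P.2 ^+ 3.

Definition opp_pt P : K * K * K := (P.1.2, P.1.1, P.2).

(* On u^3 + v^3 = m w^3 with neutral element (-1 : 1 : 0), chord P Q and
   tangent P are coordinate vectors of P + Q and of 2 P; beware that chord P Q
   is zero when P = Q. *)
Definition chord P Q : K * K * K :=
  let: (u1, v1, w1) := P in let: (u2, v2, w2) := Q in
  (v1 ^+ 2 * u2 * w2 - v2 ^+ 2 * u1 * w1,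
   u1 ^+ 2 * v2 * w2 - u2 ^+ 2 * v1 * w1,
   w1 ^+ 2 * u2 * v2 - w2 ^+ 2 * u1 * v1).

Definition tangent P : K * K * K :=
  let: (u, v, w) := P in
  (- v * (2 * u ^+ 3 + v ^+ 3), u * (u ^+ 3 + 2 * v ^+ 3),
   w * (u ^+ 3 - v ^+ 3)).

Lemma proportional_refl P : proportional P P.
Proof. by exists 1, 1; rewrite oner_neq0. Qed.

Lemma proportional_sym P Q : proportional P Q -> proportional Q P.
Proof. by case=> a [b [a0 b0 E]]; exists b, a. Qed.

Lemma scaleM a b P : scale a (scale b P) = scale (a * b) P.
Proof. by rewrite /scale /= !mulrA. Qed.

Lemma proportional_trans P Q X :
  proportional P Q -> proportional Q X -> proportional P X.
Proof.
case=> a [b [a0 b0 E]] [c [d [c0 d0 F]]].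
exists (c * a), (b * d); rewrite !mulf_neq0 //; split=> //.
by rewrite -scaleM E scaleM mulrC -!scaleM F.
Qed.

Lemma scale_eq0 a P : a != 0 -> (scale a P == 0) = (P == 0).
Proof.
case: P => [[u v] w] a0; rewrite /scale /=.
by rewrite !xpair_eqE !mulf_eq0 (negPf a0).
Qed.

Lemma proportional_eq0 P Q : proportional P Q -> (P == 0) = (Q == 0).
Proof.
by case=> a [b [a0 b0 E]]; rewrite -(scale_eq0 _ a0) E scale_eq0.
Qed.

Lemma proportional_w_eq0 P Q : proportional P Q -> (P.2 == 0) = (Q.2 == 0).
Proof.
case=> a [b [a0 b0 E]].
have /eqP := congr1 snd E; rewrite /= => /eqP F.
have : (a * P.2 == 0) = (b * Q.2 == 0) by rewrite F.
by rewrite !mulf_eq0 (negPf a0) (negPf b0).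
Qed.

Lemma scale_chord a b P Q :
  chord (scale a P) (scale b Q) = scale (a ^+ 2 * b ^+ 2) (chord P Q).
Proof.
case: P Q => [[u1 v1] w1] [[u2 v2] w2]; rewrite /chord /scale /=.
by congr (_, _, _); ring.
Qed.

Lemma scale_tangent a P : tangent (scale a P) = scale (a ^+ 4) (tangent P).
Proof.
by case: P => [[u v] w]; rewrite /tangent /scale /=; congr (_, _, _); ring.
Qed.

Lemma proportional_opp P Q :
  proportional P Q -> proportional (opp_pt P) (opp_pt Q).
Proof.
by case=> a [b [a0 b0 [E1 E2 E3]]]; exists a, b; rewrite /scale /= E1 E2 E3.
Qed.

Lemma opp_ptK P : opp_pt (opp_pt P) = P.
Proof. by case: P => [[]]. Qed.

Lemma proportional_chord P P' Q Q' :
  proportional P P' -> proportional Q Q' ->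
  proportional (chord P Q) (chord P' Q').
Proof.
case=> a [b [a0 b0 E]] [c [d [c0 d0 F]]].
exists (a ^+ 2 * c ^+ 2), (b ^+ 2 * d ^+ 2).
by rewrite !mulf_neq0 ?expf_neq0 // -!scale_chord E F.
Qed.

Lemma proportional_tangent P P' :
  proportional P P' -> proportional (tangent P) (tangent P').
Proof.
case=> a [b [a0 b0 E]]; exists (a ^+ 4), (b ^+ 4).
by rewrite !expf_neq0 // -!scale_tangent E.
Qed.

(** The equations are the vanishing of the 2x2 minors. The case split looks for a coordinate that is
    non-zero in both vectors; its two values are the multipliers. *)
Lemma proportional_cross P Q : P != 0 -> Q != 0 ->
    P.1.1 * Q.1.2 = P.1.2 * Q.1.1 -> P.1.2 * Q.2 = P.2 * Q.1.2 ->
    P.1.1 * Q.2 = P.2 * Q.1.1 ->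
  proportional P Q.
Proof.
case: P Q => [[u1 v1] w1] [[u2 v2] w2] /= P0 Q0 E1 E2 E3.
have [w10|w10] := eqVneq w1 0; last first.
  have [w20|w20] := eqVneq w2 0; last first.
    exists w2, w1; split=> //; rewrite /scale /=.
    by congr (_, _, _); rewrite mulrC ?E3 ?E2.
  move: E2 E3 Q0; rewrite w20 !mulr0 => /esym/eqP; rewrite mulf_eq0 (negPf w10).
  move=> /eqP-> /esym/eqP; rewrite mulf_eq0 (negPf w10) => /eqP->.
  by rewrite eqxx.
move: E2 E3; rewrite w10 !mul0r => /eqP; rewrite mulf_eq0.
have [w20 _ _|w20] := eqVneq w2 0; last first.
  rewrite orbF => /eqP v10 /eqP; rewrite mulf_eq0 (negPf w20) orbF => /eqP u10.
  by move: P0; rewrite w10 v10 u10 eqxx.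
subst w1 w2; have [v10|v10] := eqVneq v1 0.
  move: E1; rewrite v10 mul0r => /eqP; rewrite mulf_eq0.
  have [u10|u10] := eqVneq u1 0; first by move: P0; rewrite v10 u10 eqxx.
  move=> /= /eqP v20; subst v1 v2; have u20 : u2 != 0.
    by apply: contraNneq Q0 => ->.
  by exists u2, u1; split=> //; rewrite /scale /= !mulr0 mulrC.
have v20 : v2 != 0.
  apply/eqP => v20; move: E1 Q0; rewrite v20 mulr0 => /esym/eqP.
  by rewrite mulf_eq0 (negPf v10) => /eqP ->; rewrite eqxx.
exists v2, v1; split=> //; rewrite /scale /= !mulr0.
by congr (_, _, _); rewrite mulrC ?E1.
Qed.

Lemma cross_proportional P Q : proportional P Q ->
  [/\ P.1.1 * Q.1.2 = P.1.2 * Q.1.1, P.1.2 * Q.2 = P.2 * Q.1.2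
    & P.1.1 * Q.2 = P.2 * Q.1.1].
Proof.
case: P Q => [[u1 v1] w1] [[u2 v2] w2] [a [b [a0 b0 [E1 E2 E3]]]] /=.
move: a0 E1 E2 E3 => /= a0 E1 E2 E3.
split; apply: (mulfI a0).
- by rewrite mulrA E1 [RHS]mulrA E2; ring.
- by rewrite mulrA E2 [RHS]mulrA E3; ring.
- by rewrite mulrA E1 [RHS]mulrA E3; ring.
Qed.

Lemma chordC P Q : chord Q P = scale (-1) (chord P Q).
Proof.
case: P Q => [[u1 v1] w1] [[u2 v2] w2]; rewrite /chord /scale /=.
by congr (_, _, _); ring.
Qed.

Lemma proportional_chordC P Q : proportional (chord Q P) (chord P Q).
Proof.
exists 1, (-1); rewrite oppr_eq0 oner_neq0 chordC; split=> //.
by rewrite /scale /= !mul1r.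
Qed.

(** Associativity away from doublings. Each curve equation, solved for u^3, becomes a rewriting rule
    modulo which the 2x2 minors vanish identically; the next lemmas are proved in the same way. *)
Lemma chord_chord m P Q X : on_cubic m P -> on_cubic m Q -> on_cubic m X ->
    chord (chord P Q) X != 0 -> chord P (chord Q X) != 0 ->
  proportional (chord (chord P Q) X) (chord P (chord Q X)).
Proof.
case: P Q X => [[u1 v1] w1] [[u2 v2] w2] [[u3 v3] w3].
rewrite /on_cubic /= => E1 E2 E3.
have {}E1 : u1 ^+ 3 = m * w1 ^+ 3 - v1 ^+ 3 by rewrite -E1 addrK.
have {}E2 : u2 ^+ 3 = m * w2 ^+ 3 - v2 ^+ 3 by rewrite -E2 addrK.
have {}E3 : u3 ^+ 3 = m * w3 ^+ 3 - v3 ^+ 3 by rewrite -E3 addrK.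
move=> n0 n1; apply: proportional_cross; rewrite // /chord /=.
- by ring: E1 E2 E3.
- by ring: E1 E2 E3.
- by ring: E1 E2 E3.
Qed.

Lemma chord_double m P Q : on_cubic m P -> on_cubic m Q ->
    chord (chord P Q) Q != 0 -> chord P (tangent Q) != 0 ->
  proportional (chord (chord P Q) Q) (chord P (tangent Q)).
Proof.
case: P Q => [[u1 v1] w1] [[u2 v2] w2].
rewrite /on_cubic /= => E1 E2.
have {}E1 : u1 ^+ 3 = m * w1 ^+ 3 - v1 ^+ 3 by rewrite -E1 addrK.
have {}E2 : u2 ^+ 3 = m * w2 ^+ 3 - v2 ^+ 3 by rewrite -E2 addrK.
move=> n0 n1; apply: proportional_cross; rewrite // /chord /=.
- by ring: E1 E2.
- by ring: E1 E2.
- by ring: E1 E2.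
Qed.

Lemma chord_oppK m P Q : on_cubic m P -> on_cubic m Q ->
    chord (chord P Q) (opp_pt Q) != 0 -> P != 0 ->
  proportional (chord (chord P Q) (opp_pt Q)) P.
Proof.
case: P Q => [[u1 v1] w1] [[u2 v2] w2].
rewrite /on_cubic /= => E1 E2.
have {}E1 : u1 ^+ 3 = m * w1 ^+ 3 - v1 ^+ 3 by rewrite -E1 addrK.
have {}E2 : u2 ^+ 3 = m * w2 ^+ 3 - v2 ^+ 3 by rewrite -E2 addrK.
move=> n0 n1; apply: proportional_cross; rewrite // /chord /=.
- by ring: E1 E2.
- by ring: E1 E2.
- by ring: E1 E2.
Qed.

Lemma tangent_oppK m Q : on_cubic m Q ->
    chord (tangent Q) (opp_pt Q) != 0 -> Q != 0 ->
  proportional (chord (tangent Q) (opp_pt Q)) Q.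
Proof.
case: Q => [[u2 v2] w2].
rewrite /on_cubic /= => E2.
have {}E2 : u2 ^+ 3 = m * w2 ^+ 3 - v2 ^+ 3 by rewrite -E2 addrK.
move=> n0 n1; apply: proportional_cross; rewrite // /chord /=.
- by ring: E2.
- by ring: E2.
- by ring: E2.
Qed.

(** This is (P + Q) + (P - Q) = 2 P. It reduces the doubling of an arbitrary multiple to an addition
    of distinct points. *)
Lemma chord_sym m P Q : on_cubic m P -> on_cubic m Q ->
    chord (chord P Q) (chord P (opp_pt Q)) != 0 -> tangent P != 0 ->
  proportional (chord (chord P Q) (chord P (opp_pt Q))) (tangent P).
Proof.
case: P Q => [[u1 v1] w1] [[u2 v2] w2].
rewrite /on_cubic /= => E1 E2.
have {}E1 : u1 ^+ 3 = m * w1 ^+ 3 - v1 ^+ 3 by rewrite -E1 addrK.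
have {}E2 : u2 ^+ 3 = m * w2 ^+ 3 - v2 ^+ 3 by rewrite -E2 addrK.
move=> n0 n1; apply: proportional_cross; rewrite // /chord /=.
- by ring: E1 E2.
- by ring: E1 E2.
- by ring: E1 E2.
Qed.

Lemma expr3_inj (x y : K) : x ^+ 3 = y ^+ 3 -> x = y.
Proof.
move=> E; apply/eqP; rewrite -subr_eq0; apply/eqP.
have : (x - y) * ((2 * x + y) ^+ 2 + 3 * y ^+ 2) = 0.
  have -> : (x - y) * ((2 * x + y) ^+ 2 + 3 * y ^+ 2)
    = 4 * (x ^+ 3 - y ^+ 3) by ring.
  by rewrite E subrr mulr0.
move/eqP; rewrite mulf_eq0 => /orP[/eqP//|].
rewrite paddr_eq0 ?sqr_ge0 //; last by rewrite mulr_ge0 ?sqr_ge0.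
move=> /andP[].
rewrite sqrf_eq0 mulf_eq0 pnatr_eq0 sqrf_eq0 /= => /eqP A /eqP y0.
move: A; rewrite y0 addr0 subr0 => /eqP; rewrite mulf_eq0 pnatr_eq0 /=.
by move/eqP.
Qed.

Lemma on_cubic_opp m P : on_cubic m P -> on_cubic m (opp_pt P).
Proof. by rewrite /on_cubic /= addrC. Qed.

Lemma w_neq0_neq0 P : P.2 != 0 -> P != 0.
Proof. by apply: contraNneq => ->. Qed.

Lemma tangent_neq0 m P : on_cubic m P -> P.2 != 0 -> m != 0 -> tangent P != 0.
Proof.
case: P => [[u v] w] /= E w0 m0; apply/eqP => - [A B C].
have uv : u = v.
  apply: expr3_inj; move/eqP: C; rewrite mulf_eq0 (negPf w0) /= subr_eq0.
  by move/eqP.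
move: B E; rewrite uv /on_cubic /= => /eqP; rewrite (_ : v * _ = 3 * v ^+ 4).
  rewrite mulf_eq0 pnatr_eq0 expf_eq0 /= => /eqP -> /eqP.
  by rewrite !expr0n /= addr0 eq_sym mulf_eq0 expf_eq0 /= (negPf w0) (negPf m0).
by ring.
Qed.

(** The order on K matters: with a primitive cube root of unity z, the chord vector of (u, v, w) and
    (u, z v, z^2 w) vanishes too. Here the equations give equal cubes of v1 w2 and v2 w1, hence
    equality, and the curve equation then settles u. *)
Lemma chord_neq0 m P Q : on_cubic m P -> on_cubic m Q ->
    P.2 != 0 -> Q.2 != 0 -> m != 0 ->
  ~ proportional P Q -> chord P Q != 0.
Proof.
case: P Q => [[u1 v1] w1] [[u2 v2] w2] /= E1 E2 w10 w20 m0 npr.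
apply/eqP => - [A B C]; apply: npr.
have D1 : v1 ^+ 2 * u2 * w2 = v2 ^+ 2 * u1 * w1 by apply/eqP; rewrite -subr_eq0
  A.
have D2 : u1 ^+ 2 * v2 * w2 = u2 ^+ 2 * v1 * w1 by apply/eqP; rewrite -subr_eq0
  B.
have D3 : w1 ^+ 2 * u2 * v2 = w2 ^+ 2 * u1 * v1 by apply/eqP; rewrite -subr_eq0
  C.
have V : v1 * w2 = v2 * w1.
  apply: expr3_inj.
  have [k0|k0] := eqVneq (u2 * v2) 0; last first.
    apply: (mulfI k0).
    have -> : u2 * v2 * (v1 * w2) ^+ 3
      = (v1 ^+ 2 * u2 * w2) * v1 * v2 * w2 ^+ 2 by ring.
    rewrite D1.
    have -> : v2 ^+ 2 * u1 * w1 * v1 * v2 * w2 ^+ 2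
      = (w2 ^+ 2 * u1 * v1) * v2 ^+ 3 * w1 by ring.
    by rewrite -D3; ring.
  have/eqP : u1 * v1 = 0.
    apply/eqP; move: D3; rewrite -mulrA k0 mulr0 => /esym/eqP.
    by rewrite -mulrA mulf_eq0 expf_eq0 /= (negPf w20).
  rewrite mulf_eq0; move: k0 => /eqP; rewrite mulf_eq0.
  move: E1 E2; rewrite /on_cubic /= => E1 E2.
  have F : (u1 = 0) -> (u2 = 0) -> (v1 * w2) ^+ 3 = (v2 * w1) ^+ 3.
    move=> u10 u20; move: E1 E2; rewrite u10 u20 expr0n !add0r => E1 E2.
    by rewrite !exprMn E1 E2; ring.
  have N1 : u1 = 0 -> v1 = 0 -> false.
    move=> u10 v10; move/esym/eqP: E1; rewrite u10 v10 expr0n addr0.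
    by rewrite mulf_eq0 expf_eq0 /= (negPf m0) (negPf w10).
  have N2 : u2 = 0 -> v2 = 0 -> false.
    move=> u10 v10; move/esym/eqP: E2; rewrite u10 v10 expr0n addr0.
    by rewrite mulf_eq0 expf_eq0 /= (negPf m0) (negPf w20).
  case/orP => /eqP Z2; case/orP => /eqP Z1; rewrite ?Z1 ?Z2.
  - by apply: F.
  - move/eqP: D1; rewrite Z1 Z2 expr0n /= !mul0r eq_sym !mulf_eq0 ?orbb.
    rewrite (negPf w10) orbF; case/orP=> /eqP Z; first by have := N2 Z2 Z.
    by have := N1 Z Z1.
  - move/eqP: D1; rewrite Z1 Z2 expr0n /= !mul0r !mulf_eq0 ?orbb.
    rewrite (negPf w20) orbF; case/orP=> /eqP Z; first by have := N1 Z1 Z.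
    by have := N2 Z Z2.
  - by rewrite !mul0r.
have U : u1 * w2 = u2 * w1.
  apply: expr3_inj; move: E1 E2; rewrite /on_cubic /= => E1 E2.
  rewrite !exprMn.
  have -> : u1 ^+ 3 = m * w1 ^+ 3 - v1 ^+ 3 by rewrite -E1 addrK.
  have -> : u2 ^+ 3 = m * w2 ^+ 3 - v2 ^+ 3 by rewrite -E2 addrK.
  rewrite !mulrBl -!exprMn V; congr (_ - _).
  by ring.
exists w2, w1; split=> //; rewrite /scale /=.
by congr (_, _, _); rewrite mulrC ?U ?V mulrC.
Qed.

End ChordTangent.

Lemma proportional_dec (K : realDomainType) (P Q : K * K * K) :
  P != 0 -> Q != 0 -> proportional P Q \/ ~ proportional P Q.
Proof.
move=> P0 Q0.
have [E1|E1] := eqVneq (P.1.1 * Q.1.2) (P.1.2 * Q.1.1); last first.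
  by right=> /cross_proportional[/eqP]; rewrite (negPf E1).
have [E2|E2] := eqVneq (P.1.2 * Q.2) (P.2 * Q.1.2); last first.
  by right=> /cross_proportional[_ /eqP]; rewrite (negPf E2).
have [E3|E3] := eqVneq (P.1.1 * Q.2) (P.2 * Q.1.1); last first.
  by right=> /cross_proportional[_ _ /eqP]; rewrite (negPf E3).
by left; apply: proportional_cross.
Qed.

(** * Multiples of a non-torsion point *)

Section Multiples.

Variables (K : realDomainType) (m : K) (t : nat -> K * K * K).
Hypothesis m_neq0 : m != 0.
Hypothesis t_w : forall n, (0 < n)%N -> (t n).2 != 0.
Hypothesis t_cubic : forall n, (0 < n)%N -> on_cubic m (t n).
Hypothesis t_chord : forall n, (0 < n)%N -> ~ proportional (t n) (t 1) ->
  proportional (t n.+1) (chord (t n) (t 1)).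
Hypothesis t_tangent : forall n, (0 < n)%N -> proportional (t n) (t 1) ->
  proportional (t n.+1) (tangent (t 1)).

Let opp_w n : (0 < n)%N -> (opp_pt (t n)).2 != 0. Proof. exact: t_w. Qed.
Let opp_c n : (0 < n)%N -> on_cubic m (opp_pt (t n)).
Proof. by move=> n0; apply/on_cubic_opp/t_cubic. Qed.

Let chord_nz a b : (0 < a)%N -> (0 < b)%N ->
  ~ proportional (t a) (t b) -> chord (t a) (t b) != 0.
Proof.
move=> a0 b0.
exact: (chord_neq0 (t_cubic a0) (t_cubic b0) (t_w a0) (t_w b0) m_neq0).
Qed.

Let chord_opp_nz a b : (0 < a)%N -> (0 < b)%N ->
  ~ proportional (t a) (opp_pt (t b)) -> chord (t a) (opp_pt (t b)) != 0.
Proof.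
move=> a0 b0.
exact: (chord_neq0 (t_cubic a0) (opp_c b0) (t_w a0) (opp_w b0) m_neq0).
Qed.

Let tangent_nz a : (0 < a)%N -> tangent (t a) != 0.
Proof. by move=> a0; apply: (tangent_neq0 (t_cubic a0) (t_w a0) m_neq0). Qed.

Let t_nz a : (0 < a)%N -> t a != 0.
Proof. by move=> a0; apply/w_neq0_neq0/t_w. Qed.

(** Together with [tangent_opp_w], this turns every coincidence a R = - b R into a multiple with w =
    0, which [t_w] forbids. *)
Lemma chord_opp_w (P Q : K * K * K) :
  proportional P (opp_pt Q) -> (chord P Q).2 = 0.
Proof.
move=> /(fun E => proportional_chord E (proportional_refl
  Q))/proportional_w_eq0.
case: Q => [[u v] w] /= E; apply/eqP; rewrite E; apply/eqP; ring.
Qed.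

Lemma tangent_opp_w (P : K * K * K) :
  proportional P (opp_pt P) -> P.2 != 0 -> (tangent P).2 = 0.
Proof.
move=> /cross_proportional; case: P => [[u v] w] [/= _ E _] w0.
suff -> : v = u by rewrite subrr mulr0.
by apply: (mulfI w0); rewrite mulrC E.
Qed.

Lemma multiple2 : proportional (t 2) (tangent (t 1)).
Proof. exact/t_tangent/proportional_refl. Qed.

Let no_w0 n P : (0 < n)%N -> proportional (t n) P -> P.2 = 0 -> False.
Proof.
by move=> n0 /proportional_w_eq0 E P0; move: E; rewrite P0 eqxx (negPf (t_w
  n0)).
Qed.

Let t1_opp : ~ proportional (t 1) (opp_pt (t 1)).
Proof.
move/tangent_opp_w/(_ (t_w (ltnSn 0))) => E.
exact: (no_w0 _ multiple2 E).
Qed.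

Let opp1 n : (0 < n)%N -> ~ proportional (t n) (opp_pt (t 1)).
Proof.
move=> n0 E.
have [pr|npr] := proportional_dec (t_nz n0) (t_nz (ltnSn 0)).
  by apply: t1_opp; apply: proportional_trans E; apply: proportional_sym.
exact: (no_w0 _ (t_chord n0 npr) (chord_opp_w E)).
Qed.

Let distinct21 : ~ proportional (t 2) (t 1).
Proof.
move=> /(proportional_trans (proportional_sym multiple2))/cross_proportional.
have := t_cubic (ltnSn 0); have := t_w (ltnSn 0).
case: (t 1) => [[u v] w]; rewrite /on_cubic /= => w0 C [_ E2 E3].
have {}E2 : u * (u ^+ 3 + 2 * v ^+ 3) = (u ^+ 3 - v ^+ 3) * v.
  by apply: (mulfI w0); rewrite mulrC E2 mulrA.
have {}E3 : - v * (2 * u ^+ 3 + v ^+ 3) = (u ^+ 3 - v ^+ 3) * u.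
  by apply: (mulfI w0); rewrite mulrC E3 mulrA.
(* Subtracting the two relations expressing 2 R = R leaves a product. The factor u + v is non-zero
   because w is, and each other factor forces u = v = 0. *)
have : 3 * (u * v * (u - v) * (u + v)) == 0.
  rewrite (_ : 3 * _ = (u ^+ 3 - v ^+ 3) * u - - v * (2 * u ^+ 3 + v ^+ 3)
    - (u * (u ^+ 3 + 2 * v ^+ 3) - (u ^+ 3 - v ^+ 3) * v)); last by ring.
  by rewrite E2 E3 !subrr.
have H x : x ^+ 4 = 0 -> x = 0 :> K.
  by move/eqP; rewrite expf_eq0 => /eqP.
have nuv : u + v != 0.
  apply: contra_neq w0 => /addr0_eq Ev; move/esym/eqP: C.
  rewrite -Ev (_ : _ + _ = 0); last by ring.
  by rewrite mulf_eq0 (negPf m_neq0) expf_eq0 => /eqP.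
rewrite mulf_eq0 pnatr_eq0 /= mulf_eq0 (negPf nuv) orbF.
rewrite !mulf_eq0 -orbA => /or3P[] /eqP Z.
- suff v0 : v = 0 by move: nuv; rewrite Z v0 addr0 eqxx.
  apply: H; transitivity (- ((u ^+ 3 - v ^+ 3) * v)); first by rewrite Z; ring.
  by rewrite -E2 Z; ring.
- suff u0 : u = 0 by move: nuv; rewrite Z u0 addr0 eqxx.
  apply: H; transitivity ((u ^+ 3 - v ^+ 3) * u); first by rewrite Z; ring.
  by rewrite -E3 Z; ring.
- move/subr0_eq: Z => Z; move: E2 nuv; rewrite Z subrr mul0r.
  rewrite (_ : v * _ = 3 * v ^+ 4); last by ring.
  move/eqP; rewrite mulf_eq0 pnatr_eq0 expf_eq0 => /eqP->.
  by rewrite addr0 eqxx.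
Qed.

(** If (n + 1) R = R, then subtracting R with [chord_oppK] makes n R proportional to a vector with w
    = 0. *)
Let distinct1 n : (1 < n)%N -> ~ proportional (t n) (t 1).
Proof.
case: n => // n; rewrite ltnS; elim: n => // -[|n] IHn _ //.
have {}IHn := IHn isT.
have E := t_chord (ltn0Sn _) IHn.
move=> F; have G := proportional_trans (proportional_sym E) F.
have H := proportional_chord G (proportional_refl (opp_pt (t 1))).
have nz1 : chord (t 1) (opp_pt (t 1)) != 0 by apply: chord_opp_nz t1_opp.
have nz2 := proportional_eq0 H; move: nz1; rewrite -nz2 => nz1.
have := chord_oppK (t_cubic (ltn0Sn n.+1)) (t_cubic (ltnSn 0)) nz1
  (t_nz (ltn0Sn n.+1)).
move/proportional_sym/proportional_trans/(_ H) => A.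
apply: (no_w0 _ A) => //.
by case: (t 1) => [[u v] w] /=; ring.
Qed.

Let succ n : (1 < n)%N -> proportional (t n.+1) (chord (t n) (t 1)).
Proof. by move=> n1; apply: t_chord (distinct1 n1); apply: ltnW. Qed.

Let pred1 n : (0 < n)%N ->
  proportional (chord (t n.+1) (opp_pt (t 1))) (t n).
Proof.
move=> n0.
have nz := chord_opp_nz (ltn0Sn n) (ltnSn 0) (opp1 (ltn0Sn n)).
case: n n0 nz => // -[|n] _ nz.
  have A := proportional_chord multiple2 (proportional_refl (opp_pt (t 1))).
  apply: (proportional_trans A); apply: tangent_oppK (t_cubic _) _ (t_nz _) =>
    //.
  by rewrite -(proportional_eq0 A).
have A := proportional_chord (@succ n.+2 isT) (proportional_refl (opp_pt (t
  1))).
apply: (proportional_trans A).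
apply: chord_oppK (t_cubic _) (t_cubic _) _ (t_nz _) => //.
by rewrite -(proportional_eq0 A).
Qed.

(** Subtracting R from both sides by [pred1] lowers a and b together until b = 1. *)
Lemma distinct_multiples a b :
  (0 < b)%N -> (b < a)%N -> ~ proportional (t a) (t b).
Proof.
case: b => // b _; elim: b a => [|b IHb] a ba; first exact: distinct1.
case: a ba => // a; rewrite ltnS => ba E.
apply: (IHb a ba); have a0 : (0 < a)%N by apply: leq_ltn_trans ba.
apply: (proportional_trans (proportional_sym (pred1 a0))).
apply: proportional_trans (pred1 (ltn0Sn b)).
exact/proportional_chord/proportional_refl.
Qed.

(** Induction on b through (a R + b R) + R = a R + (b R + R), where b R + R is a doubling for b = 1.
    The bound b < a keeps the summands distinct, so that no chord vector vanishes. *)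
Lemma multipleD a b : (0 < b)%N -> (b < a)%N ->
  proportional (t (a + b)) (chord (t a) (t b)).
Proof.
case: b => // b _; elim: b => [|b IHb] ba; first by rewrite addn1; apply: succ.
have a0 : (0 < a)%N by apply: leq_ltn_trans ba.
have {}IHb := IHb (ltnW ba).
have nzP : chord (t a) (t b.+2) != 0 by apply/chord_nz/distinct_multiples.
have a1 : (1 < a + b.+1)%N by rewrite addnS ltnS; lia.
have Q := chord_nz (ltnW a1) (ltnSn 0) (distinct1 a1).
have A := proportional_chord IHb (proportional_refl (t 1)).
rewrite addnS; apply: (proportional_trans (succ a1)).
apply: (proportional_trans A); move: Q; rewrite (proportional_eq0 A) => Q.
case: b IHb ba nzP a1 A Q => [|b] IHb ba nzP a1 A Q.
  have B := proportional_chord (proportional_refl (t a)) multiple2.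
  apply: proportional_trans (proportional_sym B).
  rewrite (proportional_eq0 B) in nzP.
  by apply: chord_double (t_cubic _) (t_cubic _) Q nzP.
have B := proportional_chord (proportional_refl (t a)) (@succ b.+2 isT).
apply: proportional_trans (proportional_sym B).
rewrite (proportional_eq0 B) in nzP.
by apply: chord_chord (t_cubic _) (t_cubic _) (t_cubic _) Q nzP.
Qed.

(** For a > 1, 2 a R is computed as (a + 1) R + (a - 1) R, to which [chord_sym] applies with Q =
    R. *)
Lemma multiple_double a :
  (0 < a)%N -> proportional (t (a + a)) (tangent (t a)).
Proof.
case: a => // -[|a] _; first exact: multiple2.
have A := @succ a.+2 isT; have B := @pred1 a.+1 isT.
have C := @multipleD a.+3 a.+1 isT (leqnSn _).
rewrite (_ : (a.+2 + a.+2 = a.+3 + a.+1)%N); last by lia.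
apply: (proportional_trans C).
have D := proportional_chord A (proportional_sym B).
apply: (proportional_trans D).
apply: chord_sym (t_cubic _) (t_cubic _) _ (tangent_nz _) => //.
rewrite -(proportional_eq0 D); apply: chord_nz => //.
by apply: distinct_multiples.
Qed.

Lemma opp_multiples a b :
  (0 < b)%N -> (b <= a)%N -> ~ proportional (t a) (opp_pt (t b)).
Proof.
move=> b0; rewrite leq_eqVlt => /orP[/eqP <-|ba] E.
  by apply: (no_w0 _ (multiple_double b0) (tangent_opp_w E _)); rewrite
    ?addn_gt0 ?b0 ?t_w.
apply: (no_w0 _ (multipleD b0 ba) (chord_opp_w E)).
by rewrite addn_gt0 b0 orbT.
Qed.

Lemma multipleB a b : (0 < b)%N -> (b < a)%N ->
  proportional (t (a - b)) (chord (t a) (opp_pt (t b))).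
Proof.
move=> b0 ba; have a0 := leq_ltn_trans (leq0n _) ba.
have nz := chord_opp_nz a0 b0 (opp_multiples b0 (ltnW ba)).
have c0 : (0 < a - b)%N by rewrite subn_gt0.
have E : a = (a - b + b)%N by rewrite subnK // ltnW.
apply: proportional_sym; move: nz {a0 ba}.
rewrite [in chord _ _]E [in X in _ -> X]E addnK; move: (a - b)%N c0 => c c0 nz.
have [e|e] := eqVneq c b.
  move: nz; rewrite e => nz.
  have A := proportional_chord (multiple_double b0)
    (proportional_refl (opp_pt (t b))).
  apply: (proportional_trans A).
  apply: tangent_oppK (t_cubic _) _ (t_nz _) => //.
  by rewrite -(proportional_eq0 A).
have S : proportional (t (c + b)) (chord (t c) (t b)).
  have [l|l|l] := ltngtP c b; last by rewrite l eqxx in e.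
    rewrite addnC; apply: (proportional_trans (multipleD c0 l)).
    exact: proportional_chordC.
  exact: multipleD.
have A := proportional_chord S (proportional_refl (opp_pt (t b))).
apply: (proportional_trans A).
apply: chord_oppK (t_cubic _) (t_cubic _) _ (t_nz _) => //.
by rewrite -(proportional_eq0 A).
Qed.

(** Points with u v = 0 are flexes, so a R would be 3-torsion: the sum of 2 a R and a R would have w
    = 0. *)
Lemma multiple_uv_neq0 a : (0 < a)%N -> (t a).1.1 * (t a).1.2 != 0.
Proof.
move=> a0; apply/eqP => E.
have a2 : (a < a + a)%N by rewrite -[ltnLHS]addn0 ltn_add2l.
apply: (no_w0 _ (multipleD a0 a2)); first by rewrite !addn_gt0 a0.
have := cross_proportional (multiple_double a0).
have := t_cubic a0; have := t_w a0; rewrite /on_cubic.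
case: (t (a + a)) => [[x y] z]; case: (t a) E => [[u v] w] /= E w0 C [T _ _].
suff xy0 : x * y = 0 by rewrite -!mulrA E xy0; ring.
move/eqP: E; rewrite mulf_eq0 => /orP[] /eqP Z; subst.
- have v0 : - v ^+ 4 != 0.
    rewrite oppr_eq0 expf_eq0 /=; apply: contraNneq w0 => v0; move/esym/eqP: C.
    by rewrite v0 expr0n addr0 mulf_eq0 (negPf m_neq0) expf_eq0.
  suff -> : y = 0 by rewrite mulr0.
  apply: (mulIf v0); transitivity (y * (- v * (2 * 0 ^+ 3 + v ^+ 3))); first by
    ring.
  by rewrite -T; ring.
- have u0 : u ^+ 4 != 0.
    rewrite expf_eq0 /=; apply: contraNneq w0 => u0; move/esym/eqP: C.
    by rewrite u0 expr0n addr0 mulf_eq0 (negPf m_neq0) expf_eq0.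
  suff -> : x = 0 by rewrite mul0r.
  apply: (mulIf u0); transitivity (x * (u * (u ^+ 3 + 2 * 0 ^+ 3))); first by
    ring.
  by rewrite T; ring.
Qed.

(** Since inversion swaps u and v, equality would make a R a 2-torsion point. *)
Lemma multiple_neq_uv a : (0 < a)%N -> (t a).1.1 != (t a).1.2.
Proof.
move=> a0; apply/eqP => E; apply: (no_w0 _ (multiple_double a0)).
  by rewrite addn_gt0 a0.
by case: (t a) E => [[u v] w] /= ->; rewrite subrr mulr0.
Qed.

End Multiples.

(** * Cancellation in the addition formulas *)

(** A Bezout relation p u + q v = 1 exhibits the integral multiplier p x + q y. *)
Lemma proportional_primitive (X T : int * int * int) :
    proportional X T -> coprimez T.1.1 T.1.2 -> exists c, X = scale c T.
Proof.
case: X T => [[x y] z] [[u v] w] [a [b [a0 b0 [E1 E2 E3]]]] /=.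
move: E1 E2 E3 => /= E1 E2 E3 /coprimezP[[p q] /= pq].
exists (p * x + q * y).
have Eb : b = a * (p * x + q * y).
  rewrite mulrDr !(mulrCA a) E1 E2 -[LHS]mulr1 -pq; ring.
rewrite /scale /=; congr (_, _, _); apply: (mulfI a0); rewrite mulrA -Eb //.
Qed.

(* 3 u^7 and 3 v^7 lie in the ideal generated by the first two coordinates of
   tangent (u, v, w). *)
Lemma tangent_factor (P T : int * int * int) c :
  coprimez P.1.1 P.1.2 -> tangent P = scale c T -> (c %| 3)%Z.
Proof.
case: P T => [[u v] w] [[x y] z] /= cop [E1 E2 _].
have /coprimezP[[p q] /= pq] : coprimez (u ^+ 7) (v ^+ 7).
  by rewrite coprimezXl // coprimezXr.
have dA : (c %| v * (2 * u ^+ 3 + v ^+ 3))%Z.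
  by rewrite -[v * _]opprK rpredN -mulNr E1 dvdz_mulr.
have dB : (c %| u * (u ^+ 3 + 2 * v ^+ 3))%Z by rewrite E2 dvdz_mulr.
move: dA dB; set A := v * _; set B := u * _ => dA dB.
rewrite (_ : 3%Z = B * (p * (3 * u ^+ 3 + 2 * v ^+ 3) - q * (4 * u ^+ 2 * v)) +
   A * (q * (3 * v ^+ 3 + 2 * u ^+ 3) - p * (4 * u * v ^+ 2))).
  by rewrite rpredD // dvdz_mulr.
transitivity (3 * (p * u ^+ 7 + q * v ^+ 7)); first by rewrite pq.
by rewrite /A /B; ring.
Qed.

(** A form of Gauss's lemma: the product of two Bezout relations shows that the x_i y_j generate the
    unit ideal, so w divides b as soon as it divides every b x_i y_j. *)
Lemma primitive_divisor_product (b w x1 x2 y1 y2 : int)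
    (M11 M12 M21 M22 : int) :
    w != 0 -> coprimez x1 x2 -> coprimez y1 y2 ->
    w * M11 = b * (x1 * y1) -> w * M12 = b * (x1 * y2) ->
    w * M21 = b * (x2 * y1) -> w * M22 = b * (x2 * y2) ->
  exists l, b = w * l.
Proof.
move=> w0 /coprimezP[[p q] /= pq] /coprimezP[[r s] /= rs] E11 E12 E21 E22.
exists (p * r * M11 + p * s * M12 + q * r * M21 + q * s * M22).
rewrite !mulrDr !(mulrCA w) E11 E12 E21 E22.
transitivity (b * (p * x1 + q * x2) * (r * y1 + s * y2)); last by ring.
by rewrite pq rs !mulr1.
Qed.

(** Products of a coordinate of P + Q with one of P - Q have bidegree (4, 4), but modulo the curve
    these are divisible by [N.2], of bidegree (2, 2). The quotients have bidegree (2, 2), as a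
    parallelogram inequality requires. *)
Lemma sum_difference_rank1 (K : realDomainType) (m : K) (P Q : K * K * K) :
    on_cubic m P -> on_cubic m Q ->
  let: (u1, v1, w1) := P in let: (u2, v2, w2) := Q in
  let N := chord P Q in let D := chord P (opp_pt Q) in
  [/\ [/\ N.2 * (- m * w2 ^+ 2 * w1 * v1 - u1 ^+ 2 * u2 * v2)
          = - (N.1.1 * D.1.1),
        N.2 * (v2 ^+ 2 * u1 * v1 + m * w1 ^+ 2 * w2 * u2) = - (N.1.2 * D.1.1),
        N.2 * (u2 ^+ 2 * u1 * v1 + m * w1 ^+ 2 * w2 * v2) = - (N.1.1 * D.1.2)
      & N.2 * (- m * w2 ^+ 2 * w1 * u1 - v1 ^+ 2 * u2 * v2)
          = - (N.1.2 * D.1.2)],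
    N.2 * (v2 ^+ 2 * v1 * w1 - u1 ^+ 2 * u2 * w2) = - (N.2 * D.1.2)
    & N.2 * (u2 ^+ 2 * v1 * w1 - u1 ^+ 2 * v2 * w2) = - (N.1.2 * D.2)].
Proof.
case: P Q => [[u1 v1] w1] [[u2 v2] w2]; rewrite /on_cubic /= => E1 E2.
have {}E1 : u1 ^+ 3 = m * w1 ^+ 3 - v1 ^+ 3 by rewrite -E1 addrK.
have {}E2 : u2 ^+ 3 = m * w2 ^+ 3 - v2 ^+ 3 by rewrite -E2 addrK.
by split; [split| | ]; ring: E1 E2.
Qed.

(* The coordinate vectors S of P - Q and T of P + Q have a tensor product that
   is, up to the scalar l, bihomogeneous of bidegree (2, 2) in the coordinates
   of P and Q. *)
Definition sum_difference (m : int) (P Q S T : int * int * int) : Prop :=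
  let: (u1, v1, w1) := P in let: (u2, v2, w2) := Q in
  exists l : int, l != 0 /\ [/\
    [/\ - m * w2 ^+ 2 * w1 * v1 - u1 ^+ 2 * u2 * v2 = l * (S.1.1 * T.1.1),
        v2 ^+ 2 * u1 * v1 + m * w1 ^+ 2 * w2 * u2 = l * (S.1.1 * T.1.2),
        u2 ^+ 2 * u1 * v1 + m * w1 ^+ 2 * w2 * v2 = l * (S.1.2 * T.1.1)
      & - m * w2 ^+ 2 * w1 * u1 - v1 ^+ 2 * u2 * v2 = l * (S.1.2 * T.1.2)],
    v2 ^+ 2 * v1 * w1 - u1 ^+ 2 * u2 * w2 = l * (S.1.2 * T.2)
    & u2 ^+ 2 * v1 * w1 - u1 ^+ 2 * v2 * w2 = l * (S.2 * T.1.2)].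

(** Writing the chord vectors of P + Q and P - Q as a T and b S turns the identities into - T.2 M =
    b (S tensor T), with M the (2, 2) forms. As S and T are primitive, T.2 divides b, and l is the
    quotient b / (- T.2). *)
Lemma sum_difference_factor (m : int) (P Q S T : int * int * int) :
    on_cubic m P -> on_cubic m Q -> S.2 != 0 -> T.2 != 0 ->
    proportional S (chord P (opp_pt Q)) -> proportional T (chord P Q) ->
    coprimez S.1.1 S.1.2 -> coprimez T.1.1 T.1.2 ->
  sum_difference m P Q S T.
Proof.
case: P Q => [[u1 v1] w1] [[u2 v2] w2]; rewrite /sum_difference.
move=> E1 E2 Sw Tw Sp Tp Sc Tc.
have [[I11 I12 I21 I22] I23 I32] := sum_difference_rank1 E1 E2.
have := proportional_w_eq0 Tp; rewrite (negPf Tw) => /esym/negbT nz.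
have [a [N1 N2 N3]] := proportional_primitive (proportional_sym Tp) Tc.
have [b [N'1 N'2 N'3]] := proportional_primitive (proportional_sym Sp) Sc.
move: nz; rewrite [X in X != 0]N3 mulf_eq0 (negPf Tw) orbF => a0.
case: S T Sw Tw Sc Tc N1 N2 N3 N'1 N'2 N'3 {Sp Tp}
  => [[x1 y1] z1] [[x2 y2] z2] /= Sw Tw Sc Tc N1 N2 N3 N'1 N'2 N'3.
have key N M N' k l : N = a * k -> N' = b * l ->
    (w1 ^+ 2 * u2 * v2 - w2 ^+ 2 * u1 * v1) * M = - (N * N') ->
  - z2 * M = b * (l * k).
  move=> E F G; apply: (mulfI a0).
  transitivity (- ((w1 ^+ 2 * u2 * v2 - w2 ^+ 2 * u1 * v1) * M)).
    by rewrite N3; ring.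
  by rewrite G E F; ring.
have K11 : - z2 * (- m * w2 ^+ 2 * w1 * v1 - u1 ^+ 2 * u2 * v2) = b * (x1 * x2).
  exact: key N1 N'1 I11.
have K12 : - z2 * (v2 ^+ 2 * u1 * v1 + m * w1 ^+ 2 * w2 * u2) = b * (x1 * y2).
  exact: key N2 N'1 I12.
have K21 : - z2 * (u2 ^+ 2 * u1 * v1 + m * w1 ^+ 2 * w2 * v2) = b * (y1 * x2).
  exact: key N1 N'2 I21.
have K22 : - z2 * (- m * w2 ^+ 2 * w1 * u1 - v1 ^+ 2 * u2 * v2) = b * (y1 * y2).
  exact: key N2 N'2 I22.
have K23 : - z2 * (v2 ^+ 2 * v1 * w1 - u1 ^+ 2 * u2 * w2) = b * (y1 * z2).
  exact: key N3 N'2 I23.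
have K32 : - z2 * (u2 ^+ 2 * v1 * w1 - u1 ^+ 2 * v2 * w2) = b * (z1 * y2).
  exact: key N2 N'3 I32.
have nz2 : - z2 != 0 by rewrite oppr_eq0.
have [l El] := primitive_divisor_product nz2 Sc Tc K11 K12 K21 K22.
have l0 : l != 0.
  (* The chord vectors of P + Q and P - Q have the same third coordinate, because swapping u2 and v2
     leaves it unchanged. *)
  have : b != 0.
    apply: contraNneq a0 => b0; move: N'3; rewrite b0 mul0r.
    rewrite (mulrAC _ v2) N3 => /eqP.
    by rewrite mulf_eq0 (negPf Tw) orbF.
  by rewrite El mulf_eq0 negb_or => /andP[].
exists l; split=> //; split; [split| | ]; apply: (mulfI nz2);
  by rewrite [RHS]mulrA -El.
Qed.

(** * Height inequalities *)

Section Heights.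
Variable K : realDomainType.
Implicit Types (u v w m s B H : K).

(* Liouville bound: u + v is a non-zero integer and the other factor of
   u^3 + v^3 is a positive definite quadratic form. *)
Lemma norm_cubic_ge u v w m : u ^+ 3 + v ^+ 3 = m * w ^+ 3 -> 1 <= `|u + v| ->
  3 * u ^+ 2 <= 4 * (`|m| * `|w| ^+ 3).
Proof.
move=> E uv1; rewrite -normrX -normrM -E.
rewrite (_ : u ^+ 3 + _ = (u + v) * (u ^+ 2 - u * v + v ^+ 2)); last by ring.
have q0 : 0 <= 4 * (u ^+ 2 - u * v + v ^+ 2) - 3 * u ^+ 2.
  rewrite (_ : _ - _ = (u - 2 * v) ^+ 2) ?sqr_ge0 //; ring.
have q1 : 0 <= 3 * u ^+ 2 by rewrite mulr_ge0 ?sqr_ge0.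
rewrite normrM (@ger0_norm _ (_ + v ^+ 2)); last by lra.
rewrite [leRHS]mulrCA; apply: (@le_trans _ _ (4 * (u ^+ 2 - u * v + v ^+ 2))).
  by lra.
by rewrite ler_peMl //; lra.
Qed.

(** Split at s = u / 2. Below, the first form is at least 3/4 u^4, with equality at the split;
    above, the second is at least 15/16 u^4. *)
Lemma tangent_ge_aux u s B : 0 <= s -> s <= u ->
    u * (u ^+ 3 - 2 * s ^+ 3) <= B -> s * (2 * u ^+ 3 - s ^+ 3) <= B ->
  3 * u ^+ 4 <= 4 * B.
Proof.
move=> s0 su B1 B2; have u0 : 0 <= u by apply: le_trans su.
have [us|us] := lerP (2 * s) u.
  have : 8 * s ^+ 3 <= u ^+ 3.
    rewrite (_ : 8 * _ = (2 * s) ^+ 3); last by ring.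
    by rewrite lerXn2r ?nnegrE ?mulr_ge0.
  move/(ler_wpM2l u0); rewrite (_ : u * (8 * _) = 8 * (u * s ^+ 3)); last by
    ring.
  rewrite -exprS; move: B1; rewrite mulrBr -exprS.
  rewrite (_ : u * (2 * _) = 2 * (u * s ^+ 3)); last by ring.
  lra.
set X := s ^+ 3 + s ^+ 2 * u + s * u ^+ 2 - u ^+ 3.
have E : s * (2 * u ^+ 3 - s ^+ 3) = u ^+ 4 + (u - s) * X by rewrite /X; ring.
have X8 : 0 <= 8 * X + u ^+ 3.
  have -> : 8 * X + u ^+ 3 = (2 * s - u) * (4 * s ^+ 2 + 6 * s * u + 7 * u ^+
    2).
    by rewrite /X; ring.
  rewrite mulr_ge0 ?subr_ge0 ?(ltW us) //.
  by rewrite !addr_ge0 ?mulr_ge0 ?sqr_ge0 ?ler0n.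
have d0 : 0 <= u - s by rewrite subr_ge0.
have d1 : 0 <= u - 2 * (u - s) by lra.
have u3 : 0 <= u ^+ 3 by rewrite exprn_ge0.
have := mulr_ge0 d0 X8; have := mulr_ge0 d1 u3.
have : 0 <= u ^+ 4 by rewrite exprn_ge0.
rewrite (_ : (u - 2 * (u - s)) * u ^+ 3 = u ^+ 4 - 2 * ((u - s) * u ^+ 3));
  last by ring.
rewrite (_ : (u - s) * (8 * X + u ^+ 3) = 8 * ((u - s) * X) + (u - s) * u ^+
  3); last by ring.
by move: B2; rewrite E; lra.
Qed.

(** For u and v of the same sign the second form alone is at least u^4. Cancellation occurs only for
    opposite signs, which is the auxiliary lemma with s = - v. *)
Lemma tangent_ge u v B : `|v| <= `|u| ->
    `|v * (2 * u ^+ 3 + v ^+ 3)| <= B -> `|u * (u ^+ 3 + 2 * v ^+ 3)| <= B ->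
  3 * u ^+ 4 <= 4 * B.
Proof.
wlog u0 : u v / 0 <= u.
  move=> hw; have [|u0] := lerP 0 u; first exact: hw.
  move=> uv B1 B2; have := hw (- u) (- v); rewrite oppr_ge0 ltW // !normrN.
  rewrite (_ : (- u) ^+ 4 = u ^+ 4); last by ring.
  apply=> //.
    by rewrite (_ : _ * _ = v * (2 * u ^+ 3 + v ^+ 3)) //; ring.
  by rewrite (_ : _ * _ = u * (u ^+ 3 + 2 * v ^+ 3)) //; ring.
rewrite (ger0_norm u0) => uv; rewrite !ler_norml => /andP[B1 B2] /andP[_ B3].
have [v0|v0] := lerP 0 v.
  have u4 : 0 <= u ^+ 4 by rewrite exprn_ge0.
  have uv3 : 0 <= u * v ^+ 3 by rewrite mulr_ge0 ?exprn_ge0.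
  have E : u * (u ^+ 3 + 2 * v ^+ 3) = u ^+ 4 + 2 * (u * v ^+ 3) by ring.
  by move: B3; rewrite E; lra.
apply: (@tangent_ge_aux u (- v)).
- by rewrite oppr_ge0 ltW.
- by rewrite -(ltr0_norm v0).
- by rewrite (_ : _ * _ = u * (u ^+ 3 + 2 * v ^+ 3)) //; ring.
- rewrite (_ : _ * _ = - (v * (2 * u ^+ 3 + v ^+ 3))); last by ring.
  by rewrite lerNl.
Qed.

Lemma tangent_le u v H : `|u| <= H -> `|v| <= H ->
  `|u * (u ^+ 3 + 2 * v ^+ 3)| <= 3 * H ^+ 4.
Proof.
move=> uH vH; have H0 : 0 <= H by apply: le_trans uH.
have X x : `|x| <= H -> `|x| ^+ 3 <= H ^+ 3 by move=> xH; rewrite lerXn2r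
  ?nnegrE.
rewrite normrM (_ : 3 * H ^+ 4 = H * (H ^+ 3 + 2 * H ^+ 3)); last by ring.
rewrite ler_pM //; apply: (le_trans (ler_normD _ _)).
by rewrite normrX normrM normrX normr_nat lerD ?ler_wpM2l ?X.
Qed.

End Heights.

Definition height (P : int * int * int) : nat := maxn `|P.1.1| `|P.1.2|.

Lemma absz_int (x : int) : `|x|%N%:R = `|x| :> int.
Proof. by rewrite natz abszE. Qed.

Lemma height_normE (P : int * int * int) :
  `|P.1.1| <= (height P)%:R :> int /\ `|P.1.2| <= (height P)%:R :> int.
Proof.
by rewrite -!absz_int !ler_nat leq_maxl leq_maxr.
Qed.

Lemma height_w_ge (m : int) P : m != 0 -> on_cubic m P -> P.2 != 0 ->
  (3 * height P ^ 2 <= 4 * (`|m| * `|P.2| ^ 3))%N.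
Proof.
case: P => [[u v] w] m0 E /= w0; rewrite /on_cubic /= in E.
have uv : 1 <= `|u + v|.
  rewrite -absz_int (ler_nat _ 1) absz_gt0.
  apply: contraNneq w0 => /addr0_eq Ev; move/esym/eqP: E.
  have Z : u ^+ 3 + (- u) ^+ 3 = 0 by ring.
  by rewrite -Ev Z mulf_eq0 (negPf m0) expf_eq0.
rewrite -(ler_nat int) !(natrM, natrX) !absz_int /height /=.
case: (leqP `|u| `|v|) => _; rewrite !absz_int real_normK ?num_real //.
  by apply: (norm_cubic_ge (v := u)); rewrite addrC.
exact: norm_cubic_ge uv.
Qed.

Lemma height_w_le (m : int) P : on_cubic m P ->
  (`|m| * `|P.2| ^ 3 <= 2 * height P ^ 3)%N.
Proof.
have [uH vH] := height_normE P; case: P uH vH => [[u v] w].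
set H := height _; move: H => H /= uH vH E; rewrite /on_cubic /= in E.
rewrite -(ler_nat int) !(natrM, natrX) !absz_int.
have X x : `|x| <= H%:R -> `|x| ^+ 3 <= H%:R ^+ 3 :> int.
  by move=> xH; rewrite lerXn2r ?nnegrE.
rewrite -normrX -normrM -E; apply: (le_trans (ler_normD _ _)).
by rewrite !normrX mulr_natl mulr2n lerD ?X.
Qed.

Lemma height_double (c : int) (P T : int * int * int) :
    c != 0 -> tangent P = scale c T ->
  (height T <= 3 * height P ^ 4)%N.
Proof.
move=> c0; have [uH vH] := height_normE P; move: uH vH.
set H := height P; move: H => H; case: P => [[u v] w] /= uH vH.
case: T => [[x y] z] [E1 E2 _].
have c1 : 1 <= `|c| by rewrite -absz_int (ler_nat _ 1) absz_gt0.
rewrite -(ler_nat int) /height natrM natrX.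
have X s : `|c * s| <= 3 * H%:R ^+ 4 -> `|s| <= 3 * H%:R ^+ 4 :> int.
  by apply: le_trans; rewrite normrM ler_peMl.
case: (leqP `|_| `|_|) => _ /=; rewrite !absz_int; apply: X; rewrite -?E1 -?E2.
  exact: tangent_le.
rewrite mulNr normrN addrC; exact: tangent_le.
Qed.

Lemma height_double_ge (c : int) (P T : int * int * int) :
    tangent P = scale c T ->
  (3 * height P ^ 4 <= 4 * `|c| * height T)%N.
Proof.
have [] := height_normE T; set H := height T; move: H => H.
case: P T => [[u v] w] [[x y] z] /= xH yH [E1 E2 _].
rewrite -(ler_nat int) /height !(natrM, natrX) absz_int -mulrA.
have X s : `|s| <= H%:R :> int -> `|c * s| <= `|c| * H%:R.
  by move=> sH; rewrite normrM ler_wpM2l.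
have B1 : `|v * (2 * u ^+ 3 + v ^+ 3)| <= `|c| * H%:R.
  by rewrite -normrN -mulNr E1 X.
have B2 : `|u * (u ^+ 3 + 2 * v ^+ 3)| <= `|c| * H%:R by rewrite E2 X.
have e4 (s : int) : `|s| ^+ 4 = s ^+ 4.
  by rewrite (exprM `|s| 2 2) real_normK ?num_real // -exprM.
case: (leqP `|u| `|v|) => uv; rewrite absz_int e4.
  apply: (tangent_ge (v := u)).
  - by rewrite -!absz_int ler_nat.
  - by rewrite addrC.
  - by rewrite addrC.
by apply: (tangent_ge (v := v)); rewrite // -!absz_int ler_nat ltnW.
Qed.

(** From |m| >= 1 and |m w^3| <= 2 H^3 follows |w| <= 2 H, so a monomial with three factors w
    contributes 8 |m| and the other contributes 1. The cancelled factor l is a non-zero integer and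
    only helps. *)
Lemma height_sum_difference (m l : int) (P Q S T : int * int * int) :
    m != 0 -> on_cubic m P -> on_cubic m Q -> l != 0 ->
    let: (u1, v1, w1) := P in let: (u2, v2, w2) := Q in
    [/\ - m * w2 ^+ 2 * w1 * v1 - u1 ^+ 2 * u2 * v2 = l * (S.1.1 * T.1.1),
        v2 ^+ 2 * u1 * v1 + m * w1 ^+ 2 * w2 * u2 = l * (S.1.1 * T.1.2),
        u2 ^+ 2 * u1 * v1 + m * w1 ^+ 2 * w2 * v2 = l * (S.1.2 * T.1.1)
      & - m * w2 ^+ 2 * w1 * u1 - v1 ^+ 2 * u2 * v2 = l * (S.1.2 * T.1.2)] ->
  (height T * height S <= (8 * `|m| + 1) * (height P ^ 2 * height Q ^ 2))%N.
Proof.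
move=> m0 EP EQ l0.
have l1 : 1 <= `|l| by rewrite -absz_int (ler_nat _ 1) absz_gt0.
have wle (X : int * int * int) : on_cubic m X -> `|X.2| <= 2 * (height X)%:R :>
  int.
  move=> EX; have := height_w_le EX.
  have m1 : (1 <= `|m|)%N by rewrite absz_gt0.
  move=> h; rewrite -absz_int -(natrM _ 2) ler_nat -(leq_exp2r _ _ (isT : 0 <
    3)%N).
  apply: (leq_trans (leq_pmull _ m1)); apply: (leq_trans h).
  by rewrite expnMn leq_mul2r orbT.
have [uP vP] := height_normE P; have [uQ vQ] := height_normE Q.
have wP := wle P EP; have wQ := wle Q EQ; move: uP vP uQ vQ wP wQ.
set H1 := height P; set H2 := height Q; move: H1 H2 => H1 H2.
case: P Q {EP EQ} => [[u1 v1] w1] [[u2 v2] w2] /= uP vP uQ vQ wP wQ.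
case: S T => [[x y] z] [[x' y'] z'] /= [E11 E12 E21 E22].
pose A : int := H1%:R ^+ 2 * H2%:R ^+ 2.
have P4 (a b c d a' b' c' d' : int) : `|a| <= a' -> `|b| <= b' ->
    `|c| <= c' -> `|d| <= d' -> `|a * b * c * d| <= a' * b' * c' * d'.
  by move=> *; rewrite !normrM !ler_pM ?mulr_ge0.
have bnd (X Y : int) : `|X| <= 8 * A -> `|Y| <= A ->
    `|m * X + Y| <= (8 * `|m| + 1) * A.
  move=> XA YA; apply: (le_trans (ler_normD _ _)).
  by rewrite mulrDl mul1r lerD // normrM (mulrC 8) -mulrA ler_wpM2l.
have D1 : `|u1 ^+ 2 * u2 * v2| <= A.
  have -> : A = H1%:R * H1%:R * H2%:R * H2%:R by rewrite /A; ring.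
  by rewrite expr2; apply: P4.
have D2 : `|v1 ^+ 2 * u2 * v2| <= A.
  have -> : A = H1%:R * H1%:R * H2%:R * H2%:R by rewrite /A; ring.
  by rewrite expr2; apply: P4.
have D3 : `|v2 ^+ 2 * u1 * v1| <= A.
  have -> : A = H2%:R * H2%:R * H1%:R * H1%:R by rewrite /A; ring.
  by rewrite expr2; apply: P4.
have D4 : `|u2 ^+ 2 * u1 * v1| <= A.
  have -> : A = H2%:R * H2%:R * H1%:R * H1%:R by rewrite /A; ring.
  by rewrite expr2; apply: P4.
have C1 r : `|r| <= H1%:R -> `|w2 * w2 * w1 * r| <= 8 * A.
  have -> : 8 * A = 2 * H2%:R * (2 * H2%:R) * (2 * H1%:R) * H1%:R.
    by rewrite /A; ring.
  by move=> ?; apply: P4.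
have C2 r : `|r| <= H2%:R -> `|w1 * w1 * w2 * r| <= 8 * A.
  have -> : 8 * A = 2 * H1%:R * (2 * H1%:R) * (2 * H2%:R) * H2%:R.
    by rewrite /A; ring.
  by move=> ?; apply: P4.
have main (s s' : int) : `|l * (s * s')| <= (8 * `|m| + 1) * A ->
    `|s'| * `|s| <= (8 * `|m| + 1) * A.
  by apply: le_trans; rewrite !normrM mulrC ler_peMl.
have B11 : `|x'| * `|x| <= (8 * `|m| + 1) * A.
  apply: main; rewrite -E11 (_ : _ - _ = - (m * (w2 * w2 * w1 * v1) +
    u1 ^+ 2 * u2 * v2)); last by ring.
  by rewrite normrN; apply: bnd; rewrite ?C1.
have B12 : `|y'| * `|x| <= (8 * `|m| + 1) * A.
  apply: main; rewrite -E12 (_ : _ + _ = m * (w1 * w1 * w2 * u2) +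
    v2 ^+ 2 * u1 * v1); last by ring.
  by apply: bnd; rewrite ?C2.
have B21 : `|x'| * `|y| <= (8 * `|m| + 1) * A.
  apply: main; rewrite -E21 (_ : _ + _ = m * (w1 * w1 * w2 * v2) +
    u2 ^+ 2 * u1 * v1); last by ring.
  by apply: bnd; rewrite ?C2.
have B22 : `|y'| * `|y| <= (8 * `|m| + 1) * A.
  apply: main; rewrite -E22 (_ : _ - _ = - (m * (w2 * w2 * w1 * u1) +
    v1 ^+ 2 * u2 * v2)); last by ring.
  by rewrite normrN; apply: bnd; rewrite ?C1.
rewrite -(ler_nat int) /height !(natrM, natrX, natrD) absz_int -/A /=.
by case: (leqP `|x'|%N _) => _; case: (leqP `|x|%N _) => _; rewrite !absz_int.
Qed.

(** * Logarithms and sums over primes *)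

Section LnNat.
Variable R : realType.

Lemma ln_natM (a b : nat) : (0 < a)%N -> (0 < b)%N ->
  ln (a * b)%:R = ln a%:R + ln b%:R :> R.
Proof. by move=> a0 b0; rewrite natrM lnM // posrE ltr0n. Qed.

Lemma ln_natX (a k : nat) : (0 < a)%N -> ln (a ^ k)%:R = k%:R * ln a%:R :> R.
Proof. by move=> a0; rewrite natrX lnXn ?ltr0n // mulr_natl. Qed.

Lemma ler_ln_nat (a b : nat) : (0 < a)%N -> (a <= b)%N ->
  ln a%:R <= ln b%:R :> R.
Proof.
move=> a0 ab; rewrite ler_ln ?posrE ?ltr0n ?ler_nat //.
exact: leq_trans ab.
Qed.

Lemma ln_nat_prod (s : seq nat) (F : nat -> nat) :
    (forall q, q \in s -> (0 < F q)%N) ->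
  ln (\prod_(q <- s) F q)%N%:R = \sum_(q <- s) ln (F q)%:R :> R.
Proof.
elim: s => [|q s IHs] F0; first by rewrite !big_nil ln1.
rewrite !big_cons ln_natM ?IHs //.
- by move=> p ps; apply: F0; rewrite inE ps orbT.
- by apply: F0; rewrite mem_head.
- rewrite big_seq prodn_cond_gt0 // => p ps.
  by apply: F0; rewrite inE ps orbT.
Qed.

Lemma ln2_gt0 : 0 < ln 2%:R :> R. Proof. by rewrite ln_gt0 // ltr1n. Qed.

(** From 3^5 = 243 <= 256 = 2^8; the companion bound comes from 2^11 = 2048 <= 2187 = 3^7. They make
    the numerical endgame linear in ln 2 and ln 3. *)
Lemma ln3_le : 5 * ln 3%:R <= 8 * ln 2%:R :> R.
Proof. by rewrite -!ln_natX // ler_ln_nat. Qed.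

Lemma ln3_ge : 11 * ln 2%:R <= 7 * ln 3%:R :> R.
Proof. by rewrite -!ln_natX // ler_ln_nat. Qed.

(** The logarithm of 4 n^2 <= 2^n, an equality at n = 8; hence the uniform argument starts there. *)
Lemma ln_nat_le_half (n : nat) : (8 <= n)%N ->
  2 * ln n%:R <= (n%:R - 2) * ln 2%:R :> R.
Proof.
move=> n8; have n0 : (0 < n)%N by apply: leq_trans n8.
have : (4 * n ^ 2 <= 2 ^ n)%N.
  rewrite -(subnKC n8); elim: (n - 8)%N => [|k IHk] //.
  rewrite addnS [(2 ^ _.+1)%N]expnS mul2n -addnn; apply: leq_trans (leq_add IHk
    IHk).
  nia.
move/(ler_ln_nat); rewrite muln_gt0 expn_gt0 n0 => /(_ isT).
rewrite ln_natM ?expn_gt0 ?n0 // !ln_natX //.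
have -> : ln 4%:R = 2 * ln 2%:R :> R by rewrite -[4%N]/(2 ^ 2)%N ln_natX.
lra.
Qed.

End LnNat.

Section PrimeSums.
Variable R : realFieldType.

(* Telescoping 1 / (2 j + 1)^2 <= 1 / (4 j) - 1 / (4 (j + 1)), started at j = 2:
   35 / 72 is 1 / 4 + 1 / 9 + 1 / 8. *)
Lemma sum_primes_inv_square (j : nat) : (2 <= j)%N ->
  \sum_(0 <= k < j.*2.+1 | prime k) k%:R ^- 2 <= 35 / 72 - (4 * j%:R)^-1 :> R.
Proof.
move=> j2; rewrite -(subnKC j2); elim: (j - 2)%N => [|i IHi].
  rewrite /index_iota /= !big_cons big_nil /= addn0.
  have -> : 2 ^- 2 = 4^-1 :> R by congr (_ ^-1); ring.
  have -> : 3 ^- 2 = 9^-1 :> R by congr (_ ^-1); ring.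
  have -> : (4 * 2)^-1 = 8^-1 :> R by congr (_ ^-1); ring.
  lra.
rewrite addnS; have : (2 <= 2 + i)%N by [].
move: (2 + i)%N IHi => k IHk k2; have k0 : 0 < k%:R :> R by rewrite ltr0n ltnW.
rewrite doubleS big_mkcond big_nat_recr // big_nat_recr // -big_mkcond /=.
have -> : prime k.*2.+2 = false.
  apply/negbTE/negP; rewrite -doubleS => /even_prime[|]; first by lia.
  by rewrite odd_double.
rewrite addr0; set e := (if _ then _ else _).
have e_le : e <= (4 * k%:R)^-1 - (4 * k.+1%:R)^-1.
  have -> : (4 * k%:R)^-1 - (4 * k.+1%:R)^-1 = (4 * (k%:R * (k%:R + 1)))^-1 :>
    R.
    by rewrite -natr1; field; rewrite !gt_eqF // addr_gt0.
  have p1 : 0 <= (4 * (k%:R * (k%:R + 1)))^-1 :> R.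
    by rewrite invr_ge0 !mulr_ge0 ?addr_ge0 ?ler0n.
  have e2 : k.*2.+1%:R = 2 * k%:R + 1 :> R by rewrite -natr1 -mul2n natrM.
  rewrite /e; case: ifP => // _; rewrite lef_pV2 ?posrE.
  - by rewrite e2; nra.
  - by rewrite exprn_gt0 // ltr0n.
  - by rewrite !mulr_gt0 // addr_gt0.
by apply: le_trans (lerD IHk e_le) _; rewrite addrA subrK.
Qed.

Lemma sum_prime_divisors_inv_square (n : nat) :
  \sum_(q <- primes n) q%:R ^- 2 <= 35 / 72 :> R.
Proof.
have E : perm_eq (primes n)
    [seq k <- index_iota 0 n.+2.*2.+1 | k \in primes n].
  apply: uniq_perm; rewrite ?primes_uniq ?filter_uniq ?iota_uniq // => k.
  rewrite mem_filter mem_index_iota /=; have [|//] := boolP (k \in _).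
  rewrite mem_primes => /and3P[_ n0 kn]; apply/esym.
  by have := dvdn_leq n0 kn; rewrite -addnn; lia.
rewrite (perm_big _ E) big_filter.
apply: le_trans (_ : _ <= \sum_(0 <= k < n.+2.*2.+1 | prime k) k%:R ^- 2) _.
  rewrite [leLHS]big_mkcond [leRHS]big_mkcond ler_sum // => k _.
  rewrite mem_primes; case: (prime k) => //=; case: ifP => // _.
  by rewrite invr_ge0 exprn_ge0.
apply: le_trans (sum_primes_inv_square _) _ => //.
by rewrite lerBlDr lerDl invr_ge0 mulr_ge0.
Qed.

Lemma prod_primes_le (n : nat) : (0 < n)%N ->
  (\prod_(q <- primes n) q <= n)%N.
Proof.
move=> n0; rewrite [leqRHS](prod_prime_decomp n0) /primes big_map.
rewrite big_seq [leqRHS]big_seq; apply: leq_prod => -[p e] /mem_prime_decomp[pp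
  e0 _].
by rewrite /= -{1}[p]expn1 leq_exp2l ?prime_gt1.
Qed.

Lemma prod_double_primes_le (n : nat) : (0 < n)%N ->
  (\prod_(q <- primes n) (2 * q) <= n ^ 2)%N.
Proof.
move=> n0; apply: leq_trans (_ : _ <= (\prod_(q <- primes n) q) ^ 2)%N _.
  rewrite expnS expn1 -big_split /= big_seq [leqRHS]big_seq.
  apply: leq_prod => q; rewrite mem_primes => /and3P[pq _ _].
  by rewrite leq_mul2r prime_gt1 ?orbT.
by rewrite leq_exp2r // prod_primes_le.
Qed.

End PrimeSums.

(* Tate's limit h = lim f(2^k) / 4^k. *)
Section ApproximatelyQuadratic.
Local Open Scope classical_set_scope.

Variables (R : realType) (f : nat -> R) (c1 c2 c : R).
Hypothesis f_double_le : forall n, (0 < n)%N -> f (n + n)%N <= 4 * f n + c2.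
Hypothesis f_double_ge : forall n, (0 < n)%N -> 4 * f n - c1 <= f (n + n)%N.
Hypothesis f_parallelogram : forall a b, (0 < b)%N -> (b < a)%N ->
  f (a + b)%N + f (a - b)%N <= 2 * f a + 2 * f b + c.

(** The shift c1 / 3 solves 4 s = c1 + s, so the lower doubling bound makes the sequence monotone
    without moving its limit. Adding c2 / 3 does the same for the upper bound. *)
Let x (n k : nat) : R := (f (2 ^ k * n)%N - c1 / 3) * 4^-1 ^+ k.

Let q_gt0 k : 0 < 4^-1 ^+ k :> R. Proof. by rewrite exprn_gt0 ?invr_gt0. Qed.

Let double k n : (2 ^ k.+1 * n = 2 ^ k * n + 2 ^ k * n)%N.
Proof. by rewrite expnS -mulnA mul2n addnn. Qed.

Let pos k n : (0 < n)%N -> (0 < 2 ^ k * n)%N.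
Proof. by move=> n0; rewrite muln_gt0 expn_gt0. Qed.

Let x_nd n : (0 < n)%N -> nondecreasing_seq (x n).
Proof.
move=> n0; apply/nondecreasing_seqP => k; rewrite /x exprS mulrA.
rewrite ler_wpM2r ?(ltW (q_gt0 k)) //.
by have := f_double_ge (pos k n0); rewrite -double; lra.
Qed.

Let y_ni n : (0 < n)%N ->
  forall k, (f (2 ^ k * n)%N + c2 / 3) * 4^-1 ^+ k <= f n + c2 / 3.
Proof.
move=> n0; elim=> [|k IHk]; first by rewrite mul1n mulr1.
apply: le_trans IHk; rewrite exprS mulrA ler_wpM2r ?(ltW (q_gt0 k)) //.
by have := f_double_le (pos k n0); rewrite -double; lra.
Qed.

Let x_le n k : (0 < n)%N -> x n k <= f n + c2 / 3.
Proof.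
move=> n0; apply: le_trans (y_ni n0 k); rewrite ler_wpM2r ?(ltW (q_gt0 k)) //.
have := f_double_ge n0; have := f_double_le n0; lra.
Qed.

Let x_cvg n : (0 < n)%N -> cvgn (x n).
Proof.
move=> n0; apply: nondecreasing_is_cvgn; first exact: x_nd.
by exists (f n + c2 / 3) => _ [k _ <-]; apply: x_le.
Qed.

Let g (n : nat) : R := limn (x n).

Let x_g n : (0 < n)%N -> x n @ \oo --> g n. Proof. exact: x_cvg. Qed.

Let g_double n : (0 < n)%N -> g (n + n)%N = 4 * g n.
Proof.
move=> n0; apply: cvg_lim => //.
have -> : x (n + n)%N = (fun k => 4 * x n k.+1).
  apply/funext => k; rewrite /x double -mulnDr exprS; lra.
have S : (fun k => x n k.+1) @ \oo --> g n
    by have := x_g n0; rewrite -cvg_shiftS.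
exact: (cvgM (cvg_cst (4 : R)) S).
Qed.

Let g_parallelogram a b : (0 < b)%N -> (b < a)%N ->
  g (a + b)%N + g (a - b)%N <= 2 * g a + 2 * g b.
Proof.
move=> b0 ba; have a0 : (0 < a)%N by apply: ltn_trans ba.
have s0 : (0 < a + b)%N by rewrite addn_gt0 b0 orbT.
have d0 : (0 < a - b)%N by rewrite subn_gt0.
have L : x (a + b)%N \+ x (a - b)%N @ \oo --> g (a + b)%N + g (a - b)%N.
  by apply: cvgD; apply: x_g.
have q1 : `|4^-1 : R| < 1 by rewrite ger0_norm; lra.
(* The shift c1 / 3 occurs four times on the right and twice on the left, so c becomes c + 2 c1 / 3.
   Divided by 4^k it tends to 0, and the limit satisfies the inequality without error. *)
have E := @cvg_geometric R (c + 2 * c1 / 3) _ q1.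
have U : (fun k => 2 * x a k + 2 * x b k + geometric (c + 2 * c1 / 3) 4^-1 k)
    @ \oo --> 2 * g a + 2 * g b + 0.
  apply: cvgD E; apply: cvgD.
    exact: (cvgM (cvg_cst (2 : R)) (x_g a0)).
  exact: (cvgM (cvg_cst (2 : R)) (x_g b0)).
rewrite addr0 in U; apply: ler_cvg_to L U _; apply: nearW => k /=.
rewrite /x mulnDr mulnBr -!mulrDl !mulrA -!mulrDl ler_wpM2r ?(ltW (q_gt0 k)) //.
have b0' := pos k b0; have ba' : (2 ^ k * b < 2 ^ k * a)%N.
  by rewrite ltn_pmul2l ?expn_gt0.
by have := f_parallelogram b0' ba'; lra.
Qed.

Lemma approximately_quadratic : exists h : R, forall n, (0 < n)%N ->
  n%:R ^+ 2 * h - c2 / 3 <= f n <= n%:R ^+ 2 * h + c1 / 3.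
Proof.
exists (g 1) => n n0.
suff <- : g n = n%:R ^+ 2 * g 1.
  have lo : f n - c1 / 3 <= g n.
    have := nondecreasing_cvgn_le (x_nd n0) (x_cvg n0) 0%N.
    by rewrite {1}/x expn0 mul1n expr0 mulr1.
  have hi : g n <= f n + c2 / 3.
    by apply: limr_le; [exact: x_cvg | apply: nearW => k; exact: x_le].
  by rewrite lerBlDr hi -lerBlDr lo.
(* The parallelogram inequality for a + 1 and a - 1, combined with g (2 n) = 4 g n, is the reverse
   inequality. The resulting recurrence has n^2 g 1 as its solution. *)
have step a : (1 < a)%N -> g (a + 1)%N + g (a - 1)%N = 2 * g a + 2 * g 1.
  move=> a1; apply/eqP; rewrite eq_le g_parallelogram //=.
  have P : (0 < a - 1)%N by lia.
  have Q : (a - 1 < a + 1)%N by lia.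
  have := g_parallelogram P Q.
  rewrite (_ : (a + 1 + (a - 1) = a + a)%N); last by lia.
  rewrite (_ : (a + 1 - (a - 1) = 1 + 1)%N); last by lia.
  by rewrite (g_double (ltnW a1)) (g_double (ltnSn 0)); lra.
have g2 : g 2 = 2%:R ^+ 2 * g 1 by rewrite (g_double (ltnSn 0)); lra.
suff H k : g k.+1 = k.+1%:R ^+ 2 * g 1 /\ g k.+2 = k.+2%:R ^+ 2 * g 1.
  by case: n n0 => // n _; case: (H n).
elim: k => [|k [E1 E2]]; first by rewrite expr1n mul1r.
split=> //; have := step k.+2 isT; rewrite addn1 subn1 /= E1 E2.
rewrite -!natr1 => E; lra.
Qed.

End ApproximatelyQuadratic.

(** * Divisibility and p-adic valuations *)

Lemma Euclid_dvdz (p : nat) (x y : int) : prime p ->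
  (p%:Z %| x * y)%Z = (p%:Z %| x)%Z || (p%:Z %| y)%Z.
Proof. by move=> pp; rewrite !dvdzE abszM Euclid_dvdM. Qed.

Lemma Euclid_dvdzX (p n : nat) (x : int) : prime p ->
  (p%:Z %| x ^+ n)%Z = (p%:Z %| x)%Z && (0 < n)%N.
Proof. by move=> pp; rewrite !dvdzE abszX Euclid_dvdX. Qed.

Definition eqm (d x y : int) : bool := (d %| x - y)%Z.

Section CongruenceTheory.
Variable d : int.

Lemma eqm_refl x : eqm d x x. Proof. by rewrite /eqm subrr dvdz0. Qed.

Lemma eqm_trans x y z : eqm d x y -> eqm d y z -> eqm d x z.
Proof. by rewrite /eqm => xy yz; rewrite -(subrKA y) rpredD. Qed.

Lemma eqmD x y x' y' : eqm d x x' -> eqm d y y' -> eqm d (x + y) (x' + y').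
Proof. by rewrite /eqm => E F; rewrite opprD addrACA rpredD. Qed.

Lemma eqmN x x' : eqm d x x' -> eqm d (- x) (- x').
Proof. by rewrite /eqm => E; rewrite -opprD rpredN. Qed.

Lemma eqmM x y x' y' : eqm d x x' -> eqm d y y' -> eqm d (x * y) (x' * y').
Proof.
rewrite /eqm => E F; rewrite (_ : _ - _ = (x - x') * y + x' * (y - y')).
  by apply: rpredD; [apply: dvdz_mulr | apply: dvdz_mull].
by ring.
Qed.

Lemma eqmX x x' n : eqm d x x' -> eqm d (x ^+ n) (x' ^+ n).
Proof.
by move=> E; elim: n => [|n IHn]; rewrite ?eqm_refl // !exprS eqmM.
Qed.

Lemma eqm_dvd x x' : eqm d x x' -> (d %| x)%Z = (d %| x')%Z.
Proof. by rewrite /eqm => E; rewrite -[x](subrK x') rpredDl. Qed.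

Lemma eqm0 x : (d %| x)%Z -> eqm d x 0.
Proof. by rewrite /eqm subr0. Qed.

End CongruenceTheory.

Lemma eqm_weaken (d d' x y : int) : (d' %| d)%Z -> eqm d x y -> eqm d' x y.
Proof. by rewrite /eqm; apply: dvdz_trans. Qed.

Ltac eqm_congr := repeat match goal with
  | H : is_true (eqm ?d ?x ?y) |- is_true (eqm ?d ?x ?y) => exact: H
  | |- is_true (eqm _ ?x ?x) => exact: eqm_refl
  | |- is_true (eqm _ (_ + _) (_ + _)) => apply: eqmD
  | |- is_true (eqm _ (- _) (- _)) => apply: eqmN
  | |- is_true (eqm _ (_ ^+ ?n) (_ ^+ ?n)) => apply: eqmX
  | |- is_true (eqm _ (_ * _) (_ * _)) => apply: eqmM
  | |- is_true (eqm _ _ _) => exact: eqm_refl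
  end.

(** The least value, 7, is attained at (2, 1). With d = u - v and s = u + v, the identity 4 (u^3 -
    v^3) = d (d^2 + 3 s^2) leaves few pairs, excluded by the parity of d + s and the non-vanishing
    hypotheses. *)
Lemma cube_difference_gt6 (u v : int) : u <> 0 -> v <> 0 -> u <> v ->
  u + v <> 0 -> (6 < `|(u * u * u - v * v * v)%R|)%N.
Proof.
move=> u0 v0 uv nuv; rewrite ltnNge; apply/negP => D6.
have [d Ed] : exists d, d = u - v by exists (u - v).
have [s Es] : exists s, s = u + v by exists (u + v).
have E4 : 4 * (u * u * u - v * v * v) = d * (d * d + 3 * (s * s)).
  by rewrite Ed Es; ring.
have [D1 D2] : -24 <= d * (d * d + 3 * (s * s)) /\
    d * (d * d + 3 * (s * s)) <= 24 by rewrite -E4; lia.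
clear E4 D6.
have sq1 (x k : int) : 0 <= k -> k <= x \/ x <= - k -> k * k <= x * x.
  by move=> k0 [xk|xk]; nia.
have sq2 (x k : int) : 0 <= k -> x * x < k * k -> - k < x /\ x < k.
  move=> k0 xk; split; rewrite ltNge; apply/negP => h.
    by have := sq1 x k k0 (or_intror h); lia.
  by have := sq1 x k k0 (or_introl h); lia.
have ss : 1 * 1 <= s * s by apply: sq1; lia.
have [d3|d3] : (3 <= d \/ d <= -3) \/ (-2 <= d /\ d <= 2) by lia.
  have dd : 3 * 3 <= d * d by apply: sq1.
  have X12 : 12 <= d * d + 3 * (s * s) by lia.
  move: (d * d + _) X12 D1 D2 => X X12 D1 D2; clear -d3 X12 D1 D2.
  by case: d3; nia.
have [d2|d1] : (d = 2 \/ d = -2) \/ (d = 1 \/ d = -1) by lia.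
  have := sq2 s 2 isT; case: d2 => d2; rewrite d2 in D1 D2; lia.
have := sq2 s 3 isT; case: d1 => d1; rewrite d1 in D1 D2; lia.
Qed.


Lemma dvdz3P (c : int) : (c %| 3)%Z -> [\/ c = 1, c = - 1, c = 3 | c = - 3].
Proof.
move=> c3; have := dvdn_leq (isT : (0 < 3)%N) c3.
case: c c3 => -[|[|[|[|n]]]] //= _ _; by [constructor 1|constructor
  2|constructor 3|constructor 4].
Qed.

Section Divisibility.

Variables (m : int) (t : nat -> int * int * int).
Hypothesis t_cubic : forall n, (0 < n)%N -> on_cubic m (t n).
Hypothesis t_coprime : forall n, (0 < n)%N -> coprimez (t n).1.1 (t n).1.2.
Hypothesis t_w : forall n, (0 < n)%N -> (t n).2 != 0.
Hypothesis t_double : forall n, (0 < n)%N ->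
  exists c : int, (c %| 3)%Z /\ tangent (t n) = scale c (t (n + n)).
Hypothesis t_sum : forall a b, (0 < b)%N -> (b < a)%N ->
  sum_difference m (t a) (t b) (t (a - b)) (t (a + b)).

(** * Indices n for which a fixed prime divides W_n *)

Section FixedPrime.
Variable p : nat.
Hypothesis p_prime : prime p.

Lemma dvd_w_unit n : (0 < n)%N -> (p%:Z %| (t n).2)%Z ->
  ~~ (p%:Z %| (t n).1.1)%Z /\ ~~ (p%:Z %| (t n).1.2)%Z.
Proof.
move=> n0; have := t_coprime n0; have := t_cubic n0; rewrite /on_cubic.
case: (t n) => [[u v] w] /= E cop pw.
have iff : (p%:Z %| u)%Z = (p%:Z %| v)%Z.
  have : (p%:Z %| u ^+ 3 + v ^+ 3)%Z.
    by rewrite E dvdz_mull // Euclid_dvdzX // pw.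
  move=> H.
  have A : (p%:Z %| u ^+ 3)%Z = (p%:Z %| v ^+ 3)%Z.
    by rewrite -[u ^+ 3](addrK (v ^+ 3)) rpredDl // rpredN.
  by move: A; rewrite !Euclid_dvdzX // !andbT.
rewrite iff; suff npv : ~~ (p%:Z %| v)%Z by [].
apply/negP => pv; have pu : (p%:Z %| u)%Z by rewrite iff.
have : (p%:Z %| gcdz u v)%Z by rewrite dvdz_gcd pu pv.
rewrite (eqP cop) dvdz1 /= => /eqP p1.
by move: p_prime; rewrite p1.
Qed.

(** The cancelled factor c cannot absorb p: modulo p the first coordinate of the tangent vector is -
    v u^3, a unit. *)
Lemma dvd_w_double n : (0 < n)%N ->
  (p%:Z %| (t n).2)%Z -> (p%:Z %| (t (n + n)%N).2)%Z.
Proof.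
move=> n0 pw; have [pu pv] := dvd_w_unit n0 pw.
have := t_cubic n0; have [c [_]] := t_double n0; rewrite /on_cubic.
case: (t n) pw pu pv => [[u v] w] /= pw pu pv [E1 _ E3] C.
have : (p%:Z %| c * (t (n + n)%N).2)%Z by rewrite -E3 dvdz_mulr.
rewrite Euclid_dvdz // => /orP[pc|//].
have : (p%:Z %| - v * (2 * u ^+ 3 + v ^+ 3))%Z by rewrite E1 dvdz_mulr.
rewrite (_ : _ * _ = - (v * (u ^+ 3 + m * w ^+ 3))); last first.
  by rewrite -C; ring.
have dm : (p%:Z %| m * w ^+ 3)%Z by rewrite dvdz_mull // Euclid_dvdzX // pw.
by rewrite rpredN Euclid_dvdz // (negPf pv) /= rpredDr // Euclid_dvdzX //
  (negPf pu).
Qed.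

(** Each target coordinate w occurs in a (2, 2) form divisible by p. Its cofactor is prime to p,
    because it also divides another form that is a product of units modulo p. *)
Lemma dvd_w_sum a b : (0 < b)%N -> (b < a)%N ->
    (p%:Z %| (t a).2)%Z -> (p%:Z %| (t b).2)%Z ->
  (p%:Z %| (t (a + b)%N).2)%Z /\ (p%:Z %| (t (a - b)%N).2)%Z.
Proof.
move=> b0 ba; have a0 : (0 < a)%N by apply: ltn_trans ba.
move=> pa pb; have [pua pva] := dvd_w_unit a0 pa; have [pub pvb] := dvd_w_unit
  b0 pb.
have := t_sum b0 ba; rewrite /sum_difference.
case: (t a) pa pua pva => [[u1 v1] w1] /= pa pua pva.
case: (t b) pb pub pvb => [[u2 v2] w2] /= pb pub pvb [l [_ [[_ E12 E21 _] E23
  E32]]].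
have [pw1 pw2] : (p%:Z %| m * w1 ^+ 2 * w2 * v2)%Z /\
    (p%:Z %| m * w1 ^+ 2 * w2 * u2)%Z.
  by rewrite -!mulrA !(Euclid_dvdz _ _ p_prime) pb !orbT.
split.
- have : (p%:Z %| l * ((t (a - b)).1.2 * (t (a + b)).2))%Z.
    rewrite -E23 rpredB //; first by rewrite dvdz_mull.
    by rewrite dvdz_mull.
  rewrite mulrA Euclid_dvdz // => /orP[H|//].
  have : (p%:Z %| l * ((t (a - b)).1.2 * (t (a + b)).1.1))%Z.
    by rewrite mulrA dvdz_mulr.
  rewrite -E21 rpredDr // !Euclid_dvdz //.
  by rewrite (negPf pub) (negPf pua) (negPf pva).
- have : (p%:Z %| l * ((t (a - b)).2 * (t (a + b)).1.2))%Z.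
    rewrite -E32 rpredB //; first by rewrite dvdz_mull.
    by rewrite dvdz_mull.
  rewrite mulrCA Euclid_dvdz // => /orP[//|H].
  have : (p%:Z %| l * ((t (a - b)).1.1 * (t (a + b)).1.2))%Z.
    by rewrite mulrCA dvdz_mull.
  rewrite -E12 rpredDr // !Euclid_dvdz //.
  by rewrite (negPf pvb) (negPf pua) (negPf pva).
Qed.

Lemma dvd_w_mul k j : (0 < k)%N -> (0 < j)%N ->
  (p%:Z %| (t k).2)%Z -> (p%:Z %| (t (j * k)%N).2)%Z.
Proof.
move=> k0 j0 pk; case: j j0 => // j _; elim: j => [|j IHj]; first by rewrite
  mul1n.
rewrite mulSn addnC; case: j IHj => [|j] IHj; first by rewrite mul1n
  dvd_w_double.
have := dvd_w_sum k0 _ IHj pk; rewrite mulSn -[ltnLHS]addn0 ltn_add2l.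
by rewrite mulSn addn_gt0 k0 => /(_ isT)[].
Qed.

(** Euclid's algorithm by subtraction. *)
Lemma dvd_w_gcd a b : (0 < a)%N -> (0 < b)%N ->
    (p%:Z %| (t a).2)%Z -> (p%:Z %| (t b).2)%Z ->
  (p%:Z %| (t (gcdn a b)).2)%Z.
Proof.
elim: (a + b)%N {-2}a {-2}b (leqnn (a + b)%N) => [|s IHs] {}a {}b.
  by rewrite leqn0 addn_eq0 => /andP[/eqP->].
move=> les a0 b0 pa pb.
have [ltab|ltba|->] := ltngtP a b; last by rewrite gcdnn.
- have [_ pd] := dvd_w_sum a0 ltab pb pa.
  have := IHs a (b - a)%N; rewrite subnKC; last exact: ltnW.
  rewrite -[in gcdn a b](subnKC (ltnW ltab)) gcdnDl.
  by apply=> //; [lia | rewrite subn_gt0].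
- have [_ pd] := dvd_w_sum b0 ltba pa pb.
  have := IHs b (a - b)%N; rewrite subnKC; last exact: ltnW.
  rewrite (gcdnC a) -[in gcdn b a](subnKC (ltnW ltba)) gcdnDl.
  by apply=> //; [lia | rewrite subn_gt0].
Qed.

End FixedPrime.

(** * The p-adic valuation of W along the multiples of k *)

Section Valuation.

Variables (p : nat) (k : nat).
Hypothesis p_prime : prime p.
Hypothesis k_gt0 : (0 < k)%N.
Hypothesis p_dvd_w : (p%:Z %| (t k).2)%Z.

Let u := (t k).1.1.
Let v := (t k).1.2.
Let w := (t k).2.
Let e := logn p `|w|%N.
(** As p^e divides w, knowing its multiplier modulo p^2 gives the third coordinate modulo p^(e+2).
    This is enough to exclude valuations above e + 1. *)
Let d2 := p%:Z ^+ 2.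
Let de := p%:Z ^+ e.+2.

Let punit (x : int) := ~~ (p%:Z %| x)%Z.

Let punitM x y : punit x -> punit y -> punit (x * y).
Proof. by rewrite /punit Euclid_dvdz // negb_or => -> ->. Qed.

Let punitX n x : punit x -> punit (x ^+ n).
Proof. by rewrite /punit Euclid_dvdzX // negb_and => ->. Qed.

Let punitN x : punit x -> punit (- x).
Proof. by rewrite /punit rpredN. Qed.

Let uu : punit u.
Proof. by have [] := dvd_w_unit p_prime k_gt0 p_dvd_w. Qed.
Let uv : punit v.
Proof. by have [] := dvd_w_unit p_prime k_gt0 p_dvd_w. Qed.

Let dvd_pe_w : (p%:Z ^+ e %| w)%Z.
Proof. by rewrite dvdzE abszX /= pfactor_dvdnn. Qed.

Let cubeE : eqm d2 (v ^+ 3) (- u ^+ 3).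
Proof.
rewrite /eqm opprK addrC (t_cubic k_gt0) exprS mulrA dvdz_mull //.
by rewrite /d2 dvdz_exp2r.
Qed.

(* Up to units at p, and to first order at the kernel of multiplication by
   sqrt(-3) on the curve, j (u, v, w) is (u, v, j w), (v, u, - j w) or
   (u^2, - u^2, - j v w) according to j mod 3. *)
Definition residue_form (x y z : int) : Prop :=
  [\/ (x, y, z) = (u, v, 1), (x, y, z) = (v, u, - 1)
    | (x, y, z) = (u ^+ 2, - u ^+ 2, - v)].

Lemma residue_form_unit x y z : residue_form x y z ->
  [/\ punit x, punit y & punit z].
Proof.
have u1 : punit 1 by rewrite /punit dvdz1 /= neq_ltn prime_gt1 ?orbT.
by case=> -[-> -> ->]; split=> //; do ?[exact: punitN | exact: punitX | apply:
  punitN; exact: punitX].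
Qed.

Lemma eqm_mulw x y : eqm d2 x y -> eqm de (x * w) (y * w).
Proof.
rewrite /eqm -mulrBl /de -addn2 exprD mulrC => H.
exact: dvdz_mul.
Qed.

(** The left-hand sides are the three (2, 2) forms sharing the factor S.1.2, taken at j k R and k R,
    without the terms divisible by w^2 and with one factor w removed from the last. The congruence
    v^3 = - u^3 then cycles the three residue forms, h being the common factor. *)
Lemma residue_step x y z (j : nat) : residue_form x y z ->
  exists x' y' z' h, [/\ punit h, residue_form x' y' z',
    eqm d2 (u ^+ 2 * x * y) (h * x'), eqm d2 (- (y ^+ 2 * u * v)) (h * y')
    & eqm d2 (v ^+ 2 * y * (z * j%:R) - x ^+ 2 * u) (h * (z' * j.+1%:R))].
Proof.
case=> -[-> -> ->].
- exists v, u, (-1), (u ^+ 3); split; [exact: punitX | by constructor 2 | | | ].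
  + by rewrite (_ : _ * v = u ^+ 3 * v) ?eqm_refl //; ring.
  + rewrite (_ : - _ = - (v ^+ 3 * u)); last by ring.
    rewrite (_ : u ^+ 3 * u = - (- u ^+ 3 * u)); last by ring.
    by eqm_congr.
  + rewrite (_ : _ - _ = v ^+ 3 * j%:R - u ^+ 3); last by ring.
    rewrite (_ : u ^+ 3 * _ = - u ^+ 3 * j%:R - u ^+ 3).
      by eqm_congr.
    by rewrite -natr1; ring.
- exists (u ^+ 2), (- u ^+ 2), (- v), (u * v).
  split; [exact: punitM | by constructor 3 | | | ].
  + by rewrite (_ : _ * u = u * v * u ^+ 2) ?eqm_refl //; ring.
  + by rewrite (_ : - _ = u * v * - u ^+ 2) ?eqm_refl //; ring.
  + rewrite (_ : _ - _ = u * v * (- v * j.+1%:R)) ?eqm_refl //.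
    by rewrite -natr1; ring.
- exists u, v, 1, (- u ^+ 5).
  split; [by apply: punitN; exact: punitX | by constructor 1 | | | ].
  + by rewrite (_ : _ * - u ^+ 2 = - u ^+ 5 * u) ?eqm_refl //; ring.
  + by rewrite (_ : - (_ * v) = - u ^+ 5 * v) ?eqm_refl //; ring.
  + rewrite (_ : _ - _ = v ^+ 3 * u ^+ 2 * j%:R - u ^+ 5); last by ring.
    rewrite (_ : - u ^+ 5 * _ = (- u ^+ 3) * u ^+ 2 * j%:R - u ^+ 5).
      by eqm_congr.
    by rewrite -natr1; ring.
Qed.

(** Homogeneous coordinates are compared through a fraction c / d of p-units. The case j = 2 is the
    doubling formula. Each later step multiplies d^2 by l times a coordinate of the difference
    point, a unit because it divides u^2 u1 v1 modulo p. *)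
Lemma multiple_residue j : (0 < j)%N -> exists c d x y z,
  [/\ punit c, punit d, residue_form x y z &
    [/\ eqm d2 (d * (t (j * k)%N).1.1) (c * x),
        eqm d2 (d * (t (j * k)%N).1.2) (c * y)
      & eqm de (d * (t (j * k)%N).2) (c * (z * j%:R * w))]].
Proof.
case: j => // -[|j] _.
  exists 1, 1, u, v, 1; rewrite mul1n !mul1r !eqm_refl; split=> //.
  - by rewrite /punit dvdz1 /= neq_ltn prime_gt1 ?orbT.
  - by rewrite /punit dvdz1 /= neq_ltn prime_gt1 ?orbT.
  - by constructor 1.
elim: j => [|j [c [d [x [y [z [pc pd rf [Ex Ey Ez]]]]]]]].
  have [c0 [_]] := t_double k_gt0.
  rewrite [t k]surjective_pairing [(t k).1]surjective_pairing -/u -/v -/w.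
  rewrite addnn -mul2n => -[E1 E2 E3].
  have C1 : eqm d2 (- v * (2 * u ^+ 3 + v ^+ 3)) (- u ^+ 3 * v).
    rewrite (_ : - u ^+ 3 * v = - v * (2 * u ^+ 3 + - u ^+ 3)); last by ring.
    by eqm_congr.
  exists (- u ^+ 3), c0, v, u, (-1); split.
  - by apply: punitN; exact: punitX.
  - apply/negP => pc0; have : (p%:Z %| - v * (2 * u ^+ 3 + v ^+ 3))%Z.
      by rewrite E1 dvdz_mulr.
    have dp : (p%:Z %| d2)%Z by rewrite /d2 expr2 dvdz_mulr.
    rewrite (eqm_dvd (eqm_weaken dp C1)).
    by apply/negP/punitM => //; apply: punitN; exact: punitX.
  - by constructor 2.
  - split; first by rewrite -E1.
      rewrite -E2 (_ : - _ * u = u * (u ^+ 3 + 2 * - u ^+ 3)); last by ring.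
      by eqm_congr.
    rewrite -E3 mulrC (_ : - _ * _ = (u ^+ 3 - - u ^+ 3) * w); last by ring.
    by apply: eqm_mulw; eqm_congr.
have a0 : (0 < j.+2 * k)%N by rewrite muln_gt0.
have pw1 := dvd_w_mul p_prime k_gt0 (ltn0Sn j.+1) p_dvd_w.
have [pu1 pv1] := dvd_w_unit p_prime a0 pw1.
have ka : (k < j.+2 * k)%N by rewrite -[ltnLHS]mul1n ltn_pmul2r.
have [x' [y' [z' [h [ph rf' Hx Hy Hz]]]]] := residue_step j.+2 rf.
rewrite (_ : (j.+3 * k = j.+2 * k + k)%N); last by rewrite mulSn addnC.
have := t_sum k_gt0 ka; rewrite /sum_difference; move: pw1 pu1 pv1 Ex Ey Ez.
case: (t (j.+2 * k)%N) => [[u1 v1] w1] /= pw1 pu1 pv1 Ex Ey Ez.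
rewrite [t k]surjective_pairing [(t k).1]surjective_pairing -/u -/v -/w.
move=> [l [_ [[_ _ E21 E22] E23 _]]].
have d2w r : (d2 %| m * w ^+ 2 * w1 * r)%Z /\ (d2 %| m * w1 ^+ 2 * w * r)%Z.
  split.
    rewrite (_ : _ * r = w ^+ 2 * (m * w1 * r)); last by ring.
    by rewrite dvdz_mulr // /d2 dvdz_exp2r.
  rewrite (_ : _ * r = w1 ^+ 2 * (m * w * r)); last by ring.
  by rewrite dvdz_mulr // /d2 dvdz_exp2r.
exists (c ^+ 2 * h), (d ^+ 2 * (l * (t (j.+2 * k - k)).1.2)), x', y', z'.
split=> //.
- by apply: punitM => //; exact: punitX.
- apply: punitM; first exact: punitX.
  apply/negP => H; have : (p%:Z %| u ^+ 2 * u1 * v1 + m * w1 ^+ 2 * w * v)%Z.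
    by rewrite E21 mulrA dvdz_mulr.
  have [_ dw] := d2w v.
  have dp : (p%:Z %| d2)%Z by rewrite /d2 expr2 dvdz_mulr.
  have {}dw := dvdz_trans dp dw; rewrite rpredDr //.
  by apply/negP; exact: (punitM (punitM (punitX 2 uu) pu1) pv1).
split; rewrite -(mulrA (d ^+ 2)) -(mulrA l).
- rewrite -E21 -(mulrA (c ^+ 2)); apply: (eqm_trans (y := c ^+ 2 * (u ^+ 2 * x
  * y))).
    rewrite (_ : c ^+ 2 * _ = u ^+ 2 * (c * x) * (c * y) + 0); last by ring.
    rewrite (_ : d ^+ 2 * _ = u ^+ 2 * (d * u1) * (d * v1) +
      d ^+ 2 * (m * w1 ^+ 2 * w * v)); last by ring.
    apply: eqmD; first by eqm_congr.
    by apply/eqm0/dvdz_mull; have [] := d2w v.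
  by eqm_congr.
- rewrite -E22 -(mulrA (c ^+ 2)); apply: (eqm_trans (y := c ^+ 2 * - (y ^+ 2 *
  u * v))).
    rewrite (_ : c ^+ 2 * _ = - ((c * y) ^+ 2 * u * v) + 0); last by ring.
    rewrite (_ : d ^+ 2 * _ = - ((d * v1) ^+ 2 * u * v) +
      d ^+ 2 * - (m * w ^+ 2 * w1 * u1)); last by ring.
    apply: eqmD; first by eqm_congr.
    by apply/eqm0/dvdz_mull; rewrite rpredN; have [] := d2w u1.
  by eqm_congr.
- rewrite -E23.
  rewrite (_ : c ^+ 2 * h * _ = c ^+ 2 * (h * (z' * j.+3%:R)) * w); last by
    ring.
  apply: (eqm_trans (y := (v ^+ 2 * (d * v1) * (c * (z * j.+2%:R))
     - (d * u1) ^+ 2 * u) * w)).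
    rewrite (_ : d ^+ 2 * _ = v ^+ 2 * (d * v1) * (d * w1)
      + - ((d * u1) ^+ 2 * u * w)); last by ring.
    rewrite mulrDl mulNr -(mulrA (v ^+ 2 * (d * v1))).
    have {}Ez : eqm de (d * w1) (c * (z * j.+2%:R) * w) by rewrite -mulrA.
    by eqm_congr.
  apply: eqm_mulw.
  apply: (eqm_trans (y := c ^+ 2 * (v ^+ 2 * y * (z * j.+2%:R) - x ^+ 2 * u))).
    rewrite (_ : c ^+ 2 * _ = v ^+ 2 * (c * y) * (c * (z * j.+2%:R)) +
      - ((c * x) ^+ 2 * u)); last by ring.
    by eqm_congr.
  by eqm_congr.
Qed.

Lemma logn_w_mul_prime q : prime q ->
  (logn p `|(t (q * k)%N).2| <= logn p `|(t k).2| + logn p q)%N.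
Proof.
move=> pq; rewrite -/w -/e leqNgt; apply/negP => lt.
have [c [d [x [y [z [pc pd rf [_ _ Ez]]]]]]] := multiple_residue (prime_gt0 pq).
have [_ _ pz] := residue_form_unit rf.
(* Primality of q keeps the tested exponent within the precision e + 2. *)
have lq : (logn p q <= 1)%N by rewrite logn_prime // leq_b1.
have H : (p%:Z ^+ (e + logn p q).+1 %| d * (t (q * k)%N).2)%Z.
  apply: dvdz_mull; rewrite dvdzE abszX /= pfactor_dvdn //.
  by rewrite absz_gt0 t_w // muln_gt0 prime_gt0.
have dde : (p%:Z ^+ (e + logn p q).+1 %| de)%Z.
  by rewrite dvdz_exp2l // ltnS; lia.
move: H; rewrite (eqm_dvd (eqm_weaken dde Ez)).
have w0 : w != 0 by apply: t_w.
have gauss n x0 y0 : punit x0 -> (p%:Z ^+ n %| x0 * y0)%Z = (p%:Z ^+ n %| y0)%Z.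
  move=> px; apply: Gauss_dvdzr; apply: coprimezXl.
  by rewrite coprimezE prime_coprime.
rewrite gauss // -mulrA gauss // natz dvdzE abszX abszM /=.
rewrite pfactor_dvdn // ?muln_gt0 ?absz_gt0 ?w0 ?prime_gt0 //.
by rewrite lognM ?absz_gt0 ?prime_gt0 // addnC ltnn.
Qed.

End Valuation.

(** * Consequences of a missing primitive divisor *)

Hypothesis m_neq0 : m != 0.

Lemma no_primitive_divisor_dvdn n : (1 < n)%N ->
    (forall d, ~ primitive_divisor (fun k => (t k).2) n d) ->
  (`|(t n).2| %| \prod_(q <- primes n) (q * `|(t (n %/ q)%N).2|))%N.
Proof.
move=> n1 npd; have n0 := ltnW n1.
have W0 : (0 < `|(t n).2|)%N by rewrite absz_gt0 t_w.
apply/dvdn_partP => // p; rewrite mem_primes => /and3P[pp _ pW].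
(* Otherwise p itself would be a primitive divisor. *)
have [k [k0 kn pk]] : exists k, [/\ (0 < k)%N, (k < n)%N & (p%:Z %| (t k).2)%Z].
  have [/existsP[k /and3P[k0 _ pk]]|/existsPn npk] :=
    boolP [exists k : 'I_n, [&& 0 < k, (t k).2 != 0 & (p%:Z %| (t k).2)%Z]%N].
    by exists k.
  case: (npd p%:Z); split=> // [|k /andP[k0 kn] wk].
    by rewrite ltz_nat prime_gt1.
  have := npk (Ordinal kn); rewrite /= k0 wk /= => npk'.
  by apply/eqP; rewrite -[_ == _]/(coprimez _ _) coprimezE prime_coprime.
set d := gcdn n k.
have d0 : (0 < d)%N by rewrite gcdn_gt0 n0.
have pd : (p%:Z %| (t d).2)%Z.
  exact: (dvd_w_gcd pp).
have dn : (d %| n)%N by apply: dvdn_gcdl.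
have dlt : (d < n)%N by apply: leq_ltn_trans kn; rewrite dvdn_leq ?dvdn_gcdr.
have nd1 : (1 < n %/ d)%N by rewrite ltn_divRL // mul1n.
(* The gcd d is a proper divisor of n, so d divides n / q for any prime q of n / d. *)
set q := pdiv (n %/ d); have pq : prime q by apply: pdiv_prime.
have qnd : (q %| n %/ d)%N by apply: pdiv_dvd.
have qn : (q %| n)%N by apply: dvdn_trans qnd _; rewrite dvdn_div.
have nq : (n %/ q = (n %/ d %/ q) * d)%N.
  by rewrite -[in LHS](divnK dn) -(divnK qnd) mulnAC !mulnK ?prime_gt0.
have nq0 : (0 < n %/ q)%N by rewrite divn_gt0 ?prime_gt0 // dvdn_leq.
have pnq : (p%:Z %| (t (n %/ q)%N).2)%Z.
  rewrite nq; apply: (dvd_w_mul pp) => //.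
  by rewrite divn_gt0 ?prime_gt0 // dvdn_leq // ltnW.
have := logn_w_mul_prime pp nq0 pnq pq.
rewrite mulnC divnK // => le.
have q0 := prime_gt0 pq.
have w0 : (0 < `|(t (n %/ q)%N).2|)%N by rewrite absz_gt0 t_w.
rewrite p_part (@dvdn_trans (q * `|(t (n %/ q)%N).2|)) //.
  by rewrite pfactor_dvdn ?muln_gt0 ?q0 ?w0 // lognM // addnC.
have qin : q \in primes n by rewrite mem_primes pq n0 qn.
by rewrite (big_rem q qin) /= dvdn_mulr.
Qed.

Lemma no_primitive_divisor_height n : (1 < n)%N ->
    (forall d, ~ primitive_divisor (fun k => (t k).2) n d) ->
  (3 * height (t n) ^ 2
    <= 4 * \prod_(q <- primes n) (2 * q ^ 3 * height (t (n %/ q)) ^ 3))%N.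
Proof.
move=> n1 npd; have n0 := ltnW n1.
apply: leq_trans (height_w_ge m_neq0 (t_cubic n0) (t_w n0)) _.
rewrite leq_mul2l /=.
have W := dvdn_leq _ (no_primitive_divisor_dvdn n1 npd).
have {}W : (`|(t n).2| ^ 3
    <= \prod_(q <- primes n) (q ^ 3 * `|(t (n %/ q)%N).2| ^ 3))%N.
  under eq_bigr do rewrite -expnMn.
  rewrite -(big_morph (fun x => x ^ 3)%N (id2 := 1%N) (op2 := muln)) //; last
    first.
    by move=> x y; rewrite expnMn.
  rewrite leq_exp2r //; apply: W.
  rewrite big_seq prodn_cond_gt0 // => q.
  rewrite mem_primes => /and3P[pq _ qn].
  rewrite muln_gt0 prime_gt0 //= absz_gt0 t_w // divn_gt0 ?prime_gt0 //.
  exact: dvdn_leq.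
have m1 : (1 <= `|m|)%N by rewrite absz_gt0.
apply: leq_trans (leq_mul (leqnn _) W) _.
(* A single |m| stands on the left and some factor of the product has to absorb it. The other
   factors receive one as well, at no loss since |m| >= 1. *)
have : primes n != [::].
  by apply/eqP => E; have := pi_pdiv n; rewrite inE /= E n1.
have : all (fun q => 0 < n %/ q)%N (primes n).
  apply/allP => q; rewrite mem_primes => /and3P[pq _ qn].
  by rewrite divn_gt0 ?prime_gt0 // dvdn_leq.
elim: (primes n) => // q s IHs /= /andP[q0 /IHs {}IHs] _.
have step : (`|m| * (q ^ 3 * `|(t (n %/ q)%N).2| ^ 3) <=
   2 * q ^ 3 * height (t (n %/ q)) ^ 3)%N.
  rewrite (mulnCA _ (q ^ 3)%N) -(mulnA 2) (mulnCA 2) leq_mul2l (height_w_le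
    (t_cubic q0)) orbT //.
rewrite !big_cons; have [->|s0] := eqVneq s [::].
  by rewrite !big_nil !muln1.
rewrite mulnA; apply: leq_mul => //.
by apply: leq_trans (IHs s0); apply: leq_pmull.
Qed.

(** * Small heights and the case n = 2 *)

Hypothesis t_uv : forall n, (0 < n)%N -> (t n).1.1 * (t n).1.2 != 0.
Hypothesis t_neq_uv : forall n, (0 < n)%N -> (t n).1.1 != (t n).1.2.

Let double_int n : (0 < n)%N -> exists c : int,
  [/\ [\/ c = 1, c = - 1, c = 3 | c = - 3],
    - (t n).1.2 * (2 * ((t n).1.1 * (t n).1.1 * (t n).1.1) +
      (t n).1.2 * (t n).1.2 * (t n).1.2) = c * (t (n + n)%N).1.1,
    (t n).1.1 * ((t n).1.1 * (t n).1.1 * (t n).1.1 +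
      2 * ((t n).1.2 * (t n).1.2 * (t n).1.2)) = c * (t (n + n)%N).1.2 &
    (t n).2 * ((t n).1.1 * (t n).1.1 * (t n).1.1 -
      (t n).1.2 * (t n).1.2 * (t n).1.2) = c * (t (n + n)%N).2].
Proof.
move=> n0; have [c [/dvdz3P c3]] := t_double n0.
case: (t n) => [[u v] w] /= [E1 E2 E3]; exists c; split=> //.
- by rewrite -E1; ring.
- by rewrite -E2; ring.
- by rewrite -E3; ring.
Qed.

Lemma height_ge2 n : (0 < n)%N -> (2 <= height (t n))%N.
Proof.
move=> n0; have := t_uv n0; have := t_neq_uv n0; have := t_cubic n0.
have := t_w n0; rewrite /on_cubic /height; case: (t n) => [[u v] w] /=.
move=> w0 C uv; rewrite mulf_eq0 negb_or => /andP[u0 v0].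
have nuv : u != - v.
  apply: contraNneq w0 => E; move/esym/eqP: C.
  have -> : u ^+ 3 + v ^+ 3 = 0 by rewrite E; ring.
  by rewrite mulf_eq0 (negPf m_neq0) expf_eq0.
lia.
Qed.

(** If H_1 = 2, then (U_1, V_1) is (1, 2) or (1, -2) up to sign and order. The former doubles to
    absolute values 20 and 17. The latter doubles to 12 and 15, which coprimality reduces to 4 and 5
    of equal sign; that is too small, and a second doubling gives 1265. *)
Lemma small_start : [\/ (3 <= height (t 1))%N,
  height (t 1) = 2%N /\ (16 <= height (t 2))%N |
  height (t 1) = 2%N /\ (1024 <= height (t 4))%N].
Proof.
have h2 := height_ge2 (ltnSn 0).
have [h3|h3] := leqP 3 (height (t 1)); first by constructor 1.
have {h2 h3} h1 : height (t 1) = 2%N by lia.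
have [c [c3 E1 E2 _]] := double_int (ltnSn 0).
have [d [d3 F1 F2 _]] := double_int (ltn0Sn 1).
move: E1 E2 F1 F2; rewrite !addnn [1.*2]/= [2.*2]/=.
have := t_coprime (ltnSn 0); have := t_coprime (ltn0Sn 1).
have := t_uv (ltnSn 0); have := t_neq_uv (ltnSn 0).
move: h1; rewrite /height.
case: (t 1) => [[u v] w] /=; case: (t 2) => [[x y] z] /=.
case: (t 4) => [[a b] e] /= h1 uv uv0 cop2 cop1 E1 E2 F1 F2.
have u0 : u <> 0 by move=> u0; rewrite u0 mul0r eqxx in uv0.
have v0 : v <> 0 by move=> v0; rewrite v0 mulr0 eqxx in uv0.
move/eqP in uv; rewrite !coprimezE in cop1 cop2.
have ux : (u = 1 \/ u = -1) \/ (u = 2 \/ u = -2) by lia.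
have vx : (v = 1 \/ v = -1) \/ (v = 2 \/ v = -2) by lia.
have [same|opposite] :
    [\/ u = 1 /\ v = 2, u = -1 /\ v = -2, u = 2 /\ v = 1 | u = -2 /\ v = -1] \/
    [\/ u = 1 /\ v = -2, u = -1 /\ v = 2, u = 2 /\ v = -1 | u = -2 /\ v = 1].
- case: ux => -[] ?; case: vx => -[] ?; subst; try (by move: h1); try (by move:
  cop1);
  first [by left; constructor 1 | by right; constructor 1
    | by left; constructor 2 | by right; constructor 2
    | by left; constructor 3 | by right; constructor 3
    | by left; constructor 4 | by right; constructor 4].
- constructor 2; split=> //; clear -same c3 E1 E2.
  by case: same => -[? ?]; subst; case: c3 => ?; subst; lia.
have [P|Q] : ((x = 4 /\ y = 5 \/ x = -4 /\ y = -5) \/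
    (x = 5 /\ y = 4 \/ x = -5 /\ y = -4)) \/
  ((x = 12 /\ y = 15 \/ x = -12 /\ y = -15) \/
    (x = 15 /\ y = 12 \/ x = -15 /\ y = -12)).
- clear -opposite c3 E1 E2.
  by case: opposite => -[? ?]; subst; case: c3 => ?; subst; lia.
- constructor 3; split=> //; clear -P F1 F2 d3.
  by case: P => -[] -[? ?]; subst; case: d3 => ?; subst; lia.
- by move: cop2; case: Q => -[] -[-> ->].
Qed.

(** Here W_2 divides 2 W_1, while W_1 (U_1^3 - V_1^3) = c W_2 with |c| <= 3. Hence |U_1^3 - V_1^3|
    <= 6. *)
Lemma second_primitive : ~ (forall d, ~ primitive_divisor (fun k => (t k).2) 2
  d).
Proof.
move=> npd; have := no_primitive_divisor_dvdn (isT : (1 < 2)%N) npd.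
rewrite (_ : primes 2 = [:: 2%N]) // big_seq1 divnn /= => /dvdn_leq.
rewrite muln_gt0 /= absz_gt0 t_w // => /(_ isT).
have [c [c3 _ _ E]] := double_int (ltnSn 0); move: E.
have := t_uv (ltnSn 0); have := t_neq_uv (ltnSn 0).
have := t_cubic (ltnSn 0); have := t_w (ltnSn 0); rewrite /on_cubic addnn
  [1.*2]/=.
case: (t 1) => [[u v] w] /=; case: (t 2) => [[x y] z] /= w0 C uv.
rewrite mulf_eq0 negb_or => /andP[/eqP u0 /eqP v0] E le.
have c3' : (`|c| <= 3)%N by case: c3 => ->.
pose D := u * u * u - v * v * v.
have {E} E : (`|w| * `|D| = `|c| * `|z|)%N by rewrite -!abszM E.
have {E} D6 : (`|D| <= 6)%N.
  have wp : (0 < `|w|)%N by rewrite absz_gt0.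
  rewrite -(leq_pmul2l wp) E mulnC; apply: leq_trans (leq_mul le c3') _.
  by rewrite mulnAC mulnC.
have nuv : u + v <> 0.
  move=> /addr0_eq Ev; move/esym/eqP: C.
  have -> : u ^+ 3 + v ^+ 3 = 0 by rewrite -Ev; ring.
  by rewrite mulf_eq0 (negPf m_neq0) expf_eq0 /= (negPf w0).
move/eqP in uv.
by have := cube_difference_gt6 u0 v0 uv nuv; rewrite ltnNge D6.
Qed.

(** * The canonical height and the conclusion for integral sequences *)

Section LogHeight.
Variable R : realType.

Let f n : R := ln (height (t n))%:R.
Let L : R := ln 2%:R.

Let H_gt0 n : (0 < n)%N -> (0 < height (t n))%N.
Proof.
by move=> n0; apply: leq_trans (height_ge2 n0).
Qed.

Let ln4E : ln 4%:R = 2 * L. Proof. by rewrite -[4%N]/(2 ^ 2)%N ln_natX. Qed.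

Let f_double_le n : (0 < n)%N -> f (n + n)%N <= 4 * f n + ln 3%:R.
Proof.
move=> n0; have [c [c3 E]] := t_double n0.
have c0 : c != 0 by apply: contraTneq c3 => ->.
rewrite -ln_natX ?H_gt0 // addrC -ln_natM ?expn_gt0 ?H_gt0 //.
by apply: ler_ln_nat (height_double c0 E); rewrite H_gt0 ?addn_gt0 ?n0.
Qed.

Let f_double_ge n : (0 < n)%N -> 4 * f n - ln 4%:R <= f (n + n)%N.
Proof.
move=> n0; have [c [c3 E]] := t_double n0.
have nn : (0 < n + n)%N by rewrite addn_gt0 n0.
rewrite lerBlDl -ln_natX ?H_gt0 // -ln_natM ?H_gt0 //.
apply: ler_ln_nat; first by rewrite expn_gt0 H_gt0.
have c3' : (`|c| <= 3)%N by case: (dvdz3P c3) => ->.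
rewrite -(leq_pmul2l (isT : 0 < 3)%N); apply: leq_trans (height_double_ge E) _.
by rewrite mulnA leq_mul2r; apply/orP; right; lia.
Qed.

Let f_parallelogram a b : (0 < b)%N -> (b < a)%N ->
  f (a + b)%N + f (a - b)%N <= 2 * f a + 2 * f b + ln (8 * `|m| + 1)%N%:R.
Proof.
move=> b0 ba; have a0 : (0 < a)%N by apply: ltn_trans ba.
have s0 : (0 < a + b)%N by rewrite addn_gt0 a0.
have d0 : (0 < a - b)%N by rewrite subn_gt0.
have key : (height (t (a + b)) * height (t (a - b))
    <= (8 * `|m| + 1) * (height (t a) ^ 2 * height (t b) ^ 2))%N.
  have := t_sum b0 ba; rewrite /sum_difference.
  have := t_cubic a0; have := t_cubic b0.
  have := @height_sum_difference m _ (t a) (t b) (t (a - b)) (t (a + b)) m_neq0.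
  case: (t a) => [[u1 v1] w1]; case: (t b) => [[u2 v2] w2].
  move=> hsd cb ca [l [l0 [eqs _ _]]]; exact: hsd ca cb l0 eqs.
have Ha := H_gt0 a0; have Hb := H_gt0 b0.
have Hs := H_gt0 s0; have Hd := H_gt0 d0.
have P : (0 < height (t (a + b)) * height (t (a - b)))%N by rewrite muln_gt0 Hs.
have := @ler_ln_nat R _ _ P key.
have Ha2 : (0 < height (t a) ^ 2)%N by rewrite expn_gt0 Ha.
have Hb2 : (0 < height (t b) ^ 2)%N by rewrite expn_gt0 Hb.
have C0 : (0 < 8 * `|m| + 1)%N by rewrite addn1.
have P2 : (0 < height (t a) ^ 2 * height (t b) ^ 2)%N by rewrite muln_gt0 Ha2.
rewrite (ln_natM R Hs Hd) (ln_natM R C0 P2) (ln_natM R Ha2 Hb2) !ln_natX //.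
by rewrite [leRHS]addrC.
Qed.

(* The worst case is R = (-1, 2, 1), m = 7: there H_4 = 1265 > 2^10, whence
   h >= (10 - 2 / 3) ln 2 / 16. *)
Lemma log_height_bound : exists h : R, 7 / 12 * L <= h /\
  (forall n, (0 < n)%N ->
    n%:R ^+ 2 * h - ln 3%:R / 3 <= f n <= n%:R ^+ 2 * h + 2 / 3 * L).
Proof.
have [h hP] := approximately_quadratic f_double_le f_double_ge f_parallelogram.
have {}hP n : (0 < n)%N ->
    n%:R ^+ 2 * h - ln 3%:R / 3 <= f n <= n%:R ^+ 2 * h + 2 / 3 * L.
  by move=> n0; have := hP n n0; rewrite ln4E (_ : 2 * L / 3 = 2 / 3 * L) //;
    ring.
exists h; split=> //; have L0 : 0 < L by apply: ln2_gt0.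
have l3 := ln3_ge R.
case: (small_start).
- move=> h3; have /andP[_] := hP 1%N isT; rewrite expr1n mul1r.
  have := @ler_ln_nat R 3 _ isT h3; rewrite -/(f 1) -/L in l3 *; lra.
- move=> [_ h16]; have /andP[_] := hP 2%N isT.
  have := @ler_ln_nat R 16 _ isT h16; rewrite -[16%N]/(2 ^ 4)%N ln_natX //.
  rewrite -/(f 2) -/L; lra.
- move=> [_ h16]; have /andP[_] := hP 4%N isT.
  have := @ler_ln_nat R (2 ^ 10) _ isT h16; rewrite ln_natX //.
  rewrite -/(f 4) -/L; lra.
Qed.


Lemma no_primitive_divisor_log n : (1 < n)%N ->
    (forall d, ~ primitive_divisor (fun k => (t k).2) n d) ->
  ln 3%:R + 2 * f n
    <= 2 * L + \sum_(q <- primes n) (L + 3 * ln q%:R + 3 * f (n %/ q)%N).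
Proof.
move=> n1 npd; have n0 := ltnW n1.
have := no_primitive_divisor_height n1 npd.
have Hn := H_gt0 n0; have Hn2 : (0 < height (t n) ^ 2)%N by rewrite expn_gt0 Hn.
have q0 q : q \in primes n -> (0 < q)%N.
  by rewrite mem_primes => /and3P[/prime_gt0].
have Hq q : q \in primes n -> (0 < height (t (n %/ q)))%N.
  move=> qn; apply: H_gt0; rewrite divn_gt0 ?q0 //.
  by move: qn; rewrite mem_primes => /and3P[_ _ /dvdn_leq->].
have F0 q : q \in primes n -> (0 < 2 * q ^ 3 * height (t (n %/ q)) ^ 3)%N.
  by move=> qn; rewrite (muln_gt0 (2 * _)) (muln_gt0 2) !expn_gt0 (q0 _ qn) (Hq
    _ qn).
move=> le; have P : (0 < 3 * height (t n) ^ 2)%N by rewrite muln_gt0 Hn2.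
have := @ler_ln_nat R _ _ P le.
have G : (0 < \prod_(q <- primes n) (2 * q ^ 3 * height (t (n %/ q)) ^ 3))%N.
  by rewrite big_seq prodn_cond_gt0.
rewrite (ln_natM R (isT : 0 < 3)%N Hn2) (ln_natM R (isT : 0 < 4)%N G).
rewrite ln_natX // ln4E ln_nat_prod //.
congr (_ <= _ + _); rewrite big_seq [RHS]big_seq; apply: eq_bigr => q qn.
have q3 : (0 < q ^ 3)%N by rewrite expn_gt0 q0.
have h3 : (0 < height (t (n %/ q)) ^ 3)%N by rewrite expn_gt0 Hq.
have q3' : (0 < 2 * q ^ 3)%N by rewrite muln_gt0.
by rewrite (ln_natM R q3' h3) (ln_natM R (isT : 0 < 2)%N q3) (ln_natX R _ (q0 _
  qn)) (ln_natX R _ (Hq _ qn)).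
Qed.

(** Three times the upper error 2/3 L is 2 L, which joins L + 3 ln q to form 3 ln (2 q). *)
Lemma no_primitive_divisor_quadratic h n : (1 < n)%N ->
    (forall k, (0 < k)%N ->
      k%:R ^+ 2 * h - ln 3%:R / 3 <= f k <= k%:R ^+ 2 * h + 2 / 3 * L) ->
    (forall d, ~ primitive_divisor (fun k => (t k).2) n d) ->
  ln 3%:R / 3 + 2 * (n%:R ^+ 2 * h)
    <= 2 * L + 3 * (\sum_(q <- primes n) ln (2 * q)%N%:R)
      + 3 * (n%:R ^+ 2 * h) * \sum_(q <- primes n) q%:R ^- 2.
Proof.
move=> n1 hP npd; have n0 := ltnW n1.
have := no_primitive_divisor_log n1 npd; have /andP[+ _] := hP n n0.
rewrite -addrA !mulr_sumr -big_split /= => lo up.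
suff : \sum_(q <- primes n) (L + 3 * ln q%:R + 3 * f (n %/ q)%N) <=
   \sum_(q <- primes n)
     (3 * ln (2 * q)%N%:R + 3 * (n%:R ^+ 2 * h) * q%:R ^- 2) by lra.
rewrite big_seq [leRHS]big_seq; apply: ler_sum => q.
rewrite mem_primes => /and3P[pq _ qn]; have q0 := prime_gt0 pq.
have nq0 : (0 < n %/ q)%N by rewrite divn_gt0 // dvdn_leq.
have /andP[_] := hP _ nq0.
rewrite (ln_natM R (isT : 0 < 2)%N q0) -/L.
have -> : (n %/ q)%:R = n%:R / q%:R :> R.
  have qR : q%:R != 0 :> R by rewrite pnatr_eq0 -lt0n.
  by rewrite -[in RHS](divnK qn) natrM mulfK.
rewrite expr_div_n mulrAC -[3 * (_ * h) * _]mulrA; lra.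
Qed.

Lemma small_primes_ln (q : nat) : (q <= 8)%N -> (0 < q)%N -> ln (2 * q)%N%:R <=
  4 * L.
Proof.
move=> q8 q0; rewrite -(ln_natX R 4 (isT : 0 < 2)%N) ler_ln_nat ?muln_gt0 //.
by rewrite -[(2 ^ 4)%N]/(2 * 8)%N leq_mul2l.
Qed.

Lemma primitive_divisors n : (1 < n)%N ->
  exists d, primitive_divisor (fun k => (t k).2) n d.
Proof.
move=> n1; apply: contrapT => /forallNP npd.
have [n2|n2] := eqVneq n 2%N.
  apply: (second_primitive).
  by rewrite -n2.
have [h [hL hP]] := log_height_bound.
have L0 : 0 < L by apply: ln2_gt0.
have l3 := ln3_le R; have l3' := ln3_ge R; rewrite -/L in l3 l3'.
(* For n = 3 the quadratic estimate only yields h below about 0.615 L, which is compatible with h >=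
   7/12 L; keeping f 1 itself gains enough. *)
have [n3|n3] := eqVneq n 3%N.
  have := no_primitive_divisor_log n1 npd; have /andP[+ _] := hP n (ltnW n1).
  rewrite n3 (_ : primes 3 = [:: 3%N]) // big_seq1 divnn /= => lo up.
  have /andP[_ h1] := hP 1%N isT; rewrite expr1n mul1r in h1.
  case: (small_start).
  - by move=> h3; have := @ler_ln_nat R 3 _ isT h3; rewrite -/(f 1); lra.
  - by case=> h3 _; have : f 1 = L by [rewrite /f h3]; lra.
  - by case=> h3 _; have : f 1 = L by [rewrite /f h3]; lra.
have quad := no_primitive_divisor_quadratic n1 hP npd.
have [n8|n8] := ltnP n 8; last first.
  have S := sum_prime_divisors_inv_square R n.
  have n0 := ltnW n1.
  have T : \sum_(q <- primes n) ln (2 * q)%N%:R <= (n%:R - 2) * L.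
    rewrite -ln_nat_prod => [|q]; last first.
      by rewrite mem_primes muln_gt0 => /and3P[/prime_gt0].
    apply: le_trans (ln_nat_le_half R n8); rewrite -ln_natX //.
    apply: ler_ln_nat (prod_double_primes_le n0).
    rewrite big_seq prodn_cond_gt0 // => q.
    by rewrite mem_primes muln_gt0 => /and3P[/prime_gt0].
  have N8 : 8 <= n%:R :> R by rewrite (ler_nat R 8).
  set N : R := n%:R in quad T N8 *.
  have h0 : 0 <= N ^+ 2 * h by rewrite mulr_ge0 ?sqr_ge0 //; lra.
  have A := ler_wpM2l h0 S.
  (* From (N - 8)^2 >= 0: N^2 is replaced by its tangent at 8, where the final estimate is
     tightest. *)
  have B : (16 * N - 64) * L <= N ^+ 2 * L.
    by rewrite ler_wpM2r ?(ltW L0) //; nra.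
  have C := ler_wpM2l (sqr_ge0 N) hL.
  have D : 8 * L <= N * L by rewrite ler_wpM2r // ltW.
  rewrite -!mulrA in quad A; rewrite mulrBl in B T.
  rewrite (mulrCA (N ^+ 2)) in C.
  lra.
have L2 : ln (2 * 2)%N%:R = 2 * L by apply: ln4E.
have L6 : ln (2 * 3)%N%:R = L + ln 3%:R :> R by rewrite ln_natM.
have : [\/ n = 4%N, n = 5%N, n = 6%N | n = 7%N].
  by move: n n1 n2 n3 n8 {quad npd} => -[|[|[|[|[|[|[|[|n]]]]]]]] //;
    [constructor 1 | constructor 2 | constructor 3 | constructor 4].
case=> En; move: quad; rewrite En.
- rewrite (_ : primes 4 = [:: 2%N]) // !big_seq1 L2; lra.
- rewrite (_ : primes 5 = [:: 5%N]) // !big_seq1.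
  have := @small_primes_ln 5 isT isT; lra.
- rewrite (_ : primes 6 = [:: 2%N; 3%N]) // !big_cons !big_nil L2 L6; lra.
- rewrite (_ : primes 7 = [:: 7%N]) // !big_seq1.
  have := @small_primes_ln 7 isT isT; lra.
Qed.

End LogHeight.

End Divisibility.

(** * Line sections of the cubic *)

Definition row_triple (P : 'rV[rat]_3) : rat * rat * rat :=
  (P 0 0, P 0 1, P 0 2%:R).

Arguments row_triple P : simpl never.

Lemma row_triple_inj : injective row_triple.
Proof.
move=> P Q [E0 E1 E2]; apply/rowP => i.
have : (i : nat) \in [:: 0; 1; 2]%N by case: i => -[|[|[|]]].
rewrite !inE => /or3P[] /eqP Ei.
- by rewrite (_ : i = 0) //; apply: val_inj.
- by rewrite (_ : i = 1) //; apply: val_inj.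
- by rewrite (_ : i = 2%:R) //; apply: val_inj.
Qed.

Lemma row_triple_scale a P : row_triple (a *: P) = scale a (row_triple P).
Proof. by rewrite /row_triple /scale /= !mxE. Qed.

Lemma row_triple_eq0 P : (row_triple P == 0) = (P == 0).
Proof.
apply/eqP/eqP => [E|->]; last by rewrite /row_triple !mxE.
by apply: row_triple_inj; rewrite E /row_triple !mxE.
Qed.

Lemma row_triple_coords u v w : row_triple (coords u v w) = (u, v, w).
Proof. by rewrite /row_triple !mxE. Qed.

Lemma proportional_row P Q : proportional (row_triple P) (row_triple Q) ->
  exists2 a, a != 0 & Q = a *: P.
Proof.
case=> a [b [a0 b0 E]]; exists (b^-1 * a); first by rewrite mulf_neq0 ?invr_eq0.
apply: row_triple_inj; rewrite row_triple_scale -scaleM E scaleM mulVf //.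
by rewrite /scale !mul1r; case: (row_triple Q) => [[]].
Qed.

Lemma eqmx_row_proportional (P Q : 'rV[rat]_3) : P != 0 -> (P == Q)%MS ->
  proportional (row_triple P) (row_triple Q).
Proof.
move=> P0 /andP[/sub_rVP[a E] _].
have a0 : a != 0 by apply: contraNneq P0 => a0; rewrite E a0 scale0r.
exists 1, a; rewrite oner_neq0 a0; split=> //.
by rewrite E row_triple_scale scaleM mul1r.
Qed.

Definition combine (A B : rat * rat * rat) (x : rat * rat) : rat * rat * rat :=
  (x.1 * A.1.1 + x.2 * B.1.1, x.1 * A.1.2 + x.2 * B.1.2, x.1 * A.2 + x.2 * B.2).

Arguments combine A B x : simpl never.

Definition bracket2 (p x : rat * rat) : rat := p.1 * x.2 - p.2 * x.1.

Definition cubic3 (m : rat) (P : rat * rat * rat) : rat :=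
  P.1.1 ^+ 3 + P.1.2 ^+ 3 - m * P.2 ^+ 3.

Lemma on_cubic_cubic3 m P : on_cubic m P <-> cubic3 m P = 0.
Proof.
by rewrite /on_cubic /cubic3; split=> [->|/subr0_eq//]; rewrite subrr.
Qed.

(** Matrices are traded for explicit triples, on which [ring] can compute; row-freeness of the line
    becomes injectivity of [combine]. *)
Lemma line_section_combine (m : int) (P Q S : 'rV[rat]_3) :
    line_section m P Q S ->
  exists A B p q r c,
    [/\ [/\ row_triple P = combine A B p, row_triple Q = combine A B q
          & row_triple S = combine A B r],
        [/\ p != 0, q != 0, r != 0 & c != 0],
        forall x, combine A B x = 0 -> x = 0
      & forall x, cubic3 m%:~R (combine A B x)
          = c * (bracket2 p x * bracket2 q x * bracket2 r x)].
Proof.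
case=> L [p [q [r [c [fL [p0 q0 r0 c0] [-> -> ->] H]]]]].
pose pr (x : 'rV[rat]_2) := (x 0 0, x 0 1).
pose un (x : rat * rat) : 'rV[rat]_2 := \row_i (if i == 0 then x.1 else x.2).
have prK x : pr (un x) = x by rewrite /pr !mxE; case: x.
have pr0 (x : 'rV[rat]_2) : x != 0 -> pr x != 0.
  apply: contraNneq => -[E0 E1]; apply/eqP/rowP => i; rewrite mxE.
  case: i => -[|[|//]] hi; first by rewrite -[RHS]E0; congr (x _ _); apply:
    val_inj.
  by rewrite -[RHS]E1; congr (x _ _); apply: val_inj.
pose A := row_triple (row 0 L); pose B := row_triple (row 1 L).
have mulE (x : 'rV[rat]_2) : row_triple (x *m L) = combine A B (pr x).
  rewrite /row_triple /combine /= !mxE !big_ord_recl !big_ord0 !addr0.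
  have -> : lift ord0 ord0 = 1 :> 'I_2 by apply: val_inj.
  by [].
exists A, B, (pr p), (pr q), (pr r), c; split=> //.
- by split; rewrite ?pr0.
- move=> x E; rewrite -[x]prK; suff -> : un x = 0 by rewrite /pr !mxE.
  apply/eqP; rewrite -(mulmx_free_eq0 _ fL) -row_triple_eq0 mulE prK E.
  by [].
- move=> x; have := H (un x); rewrite /bracket /bracket2.
  rewrite -[x in X in _ -> X]prK -mulE => <-.
  by rewrite /cubic3 /cubic /row_triple.
Qed.

Section LineSections.
Variable m : int.
Let mq : rat := m%:~R.

(** Let F be the cubic form. For P and Q on the curve, F(s P + t Q) = 3 s t (a s + b t), where a and
    b are the polar forms of F at (P, P, Q) and (P, Q, Q); the remaining root is (s, t) = (b, -
    a). *)
Definition third_point (P Q : rat * rat * rat) : rat * rat * rat :=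
  let: (u1, v1, w1) := P in let: (u2, v2, w2) := Q in
  let a := u1 ^+ 2 * u2 + v1 ^+ 2 * v2 - mq * w1 ^+ 2 * w2 in
  let b := u1 * u2 ^+ 2 + v1 * v2 ^+ 2 - mq * w1 * w2 ^+ 2 in
  (u1 * b - u2 * a, v1 * b - v2 * a, w1 * b - w2 * a).

Lemma line_section_cubic P Q S : line_section m P Q S ->
  [/\ on_cubic mq (row_triple P), on_cubic mq (row_triple Q)
    & on_cubic mq (row_triple S)] /\
  [/\ row_triple P != 0, row_triple Q != 0 & row_triple S != 0].
Proof.
case/line_section_combine=> A [B [p [q [r [c [[-> -> ->] [p0 q0 r0 _] I H]]]]]].
have br x : bracket2 x x = 0 by rewrite /bracket2 mulrC subrr.
split.
  by split; apply/on_cubic_cubic3; rewrite H br ?(mul0r, mulr0).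
have nz x : x != 0 -> combine A B x != 0.
  by move=> x0; apply: contra_neq x0; apply: I.
by split; apply: nz.
Qed.

(** The factorisation is an identity of functions; its values at p + q and p - q isolate the two
    polar forms. *)
Lemma line_section_third P Q S : line_section m P Q S ->
    ~ proportional (row_triple P) (row_triple Q) ->
  proportional (row_triple S) (third_point (row_triple P) (row_triple Q)).
Proof.
move=> ls; have [[/on_cubic_cubic3 cP /on_cubic_cubic3 cQ _] _] :=
  line_section_cubic ls.
case/line_section_combine: ls cP cQ.
move=> A [B [p [q [r [c [[-> -> ->] [p0 q0 r0 c0] I H]]]]]] cP cQ npr.
pose d := bracket2 p q.
have d0 : d != 0.
  apply/eqP => d0; apply: npr; move: d0; rewrite {}/d /bracket2 => /subr0_eq d0.
  case: p q p0 q0 d0 {cP cQ H} => [p1 p2] [q1 q2] /= p0 q0 d0.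
  have [p10|p10] := eqVneq p1 0.
    have p20 : p2 != 0 by apply: contraNneq p0 => ->; rewrite p10.
    move/esym/eqP: d0; rewrite p10 mul0r mulf_eq0 (negPf p20) /= => /eqP q10.
    have q20 : q2 != 0 by apply: contraNneq q0 => ->; rewrite q10.
    exists q2, p2; split=> //; rewrite /scale /combine /= q10.
    by congr (_, _, _); ring.
  have q10 : q1 != 0.
    apply: contraNneq q0 => q10; move/eqP: d0; rewrite q10 mulr0 mulf_eq0.
    by rewrite (negPf p10) /= => /eqP ->.
  exists q1, p1; split=> //; rewrite /scale /combine /= !mulrDr !mulrA.
  by rewrite d0 (mulrC q1 p1) (mulrC q1 p2).
have H1 := H (p.1 + q.1, p.2 + q.2); have H2 := H (p.1 - q.1, p.2 - q.2).
exists (- (c * d ^+ 3)), 3; split=> //.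
  by rewrite oppr_eq0 mulf_neq0 ?expf_neq0.
move: cP cQ H1 H2; rewrite /third_point /scale /combine /cubic3 /d /bracket2 /=.
case: p q r A B {d d0 npr I H p0 q0 r0} => [p1 p2] [q1 q2] [r1 r2].
move=> [[a1 a2] a3] [[b1 b2] b3] /=.
set P1 := p1 * a1 + _; set P2 := p1 * a2 + _; set P3 := p1 * a3 + _.
set Q1 := q1 * a1 + _; set Q2 := q1 * a2 + _; set Q3 := q1 * a3 + _ => cP cQ.
have -> : (p1 + q1) * a1 + (p2 + q2) * b1 = P1 + Q1 by rewrite /P1 /Q1; ring.
have -> : (p1 + q1) * a2 + (p2 + q2) * b2 = P2 + Q2 by rewrite /P2 /Q2; ring.
have -> : (p1 + q1) * a3 + (p2 + q2) * b3 = P3 + Q3 by rewrite /P3 /Q3; ring.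
have -> : (p1 - q1) * a1 + (p2 - q2) * b1 = P1 - Q1 by rewrite /P1 /Q1; ring.
have -> : (p1 - q1) * a2 + (p2 - q2) * b2 = P2 - Q2 by rewrite /P2 /Q2; ring.
have -> : (p1 - q1) * a3 + (p2 - q2) * b3 = P3 - Q3 by rewrite /P3 /Q3; ring.
set d := p1 * q2 - p2 * q1; set rp := r1 * p2 - r2 * p1.
set rq := r1 * q2 - r2 * q1 => H1 H2.
pose G := P1 ^+ 2 * Q1 + P2 ^+ 2 * Q2 - mq * P3 ^+ 2 * Q3.
pose B' := P1 * Q1 ^+ 2 + P2 * Q2 ^+ 2 - mq * P3 * Q3 ^+ 2.
have {}H1 : 3 * G + 3 * B' = - (c * d ^+ 2 * (rp + rq)).
  transitivity ((P1 + Q1) ^+ 3 + (P2 + Q2) ^+ 3 - mq * (P3 + Q3) ^+ 3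
    - (P1 ^+ 3 + P2 ^+ 3 - mq * P3 ^+ 3) - (Q1 ^+ 3 + Q2 ^+ 3 - mq * Q3 ^+ 3)).
    by rewrite /G /B'; ring.
  by rewrite cP cQ H1 /d /rp /rq; ring.
have {}H2 : - (3 * G) + 3 * B' = c * d ^+ 2 * (rp - rq).
  transitivity ((P1 - Q1) ^+ 3 + (P2 - Q2) ^+ 3 - mq * (P3 - Q3) ^+ 3
    - (P1 ^+ 3 + P2 ^+ 3 - mq * P3 ^+ 3) + (Q1 ^+ 3 + Q2 ^+ 3 - mq * Q3 ^+ 3)).
    by rewrite /G /B'; ring.
  by rewrite cP cQ H2 /d /rp /rq; ring.
have GE : 3 * G = - (c * d ^+ 2 * rp) by lra.
have BE : 3 * B' = - (c * d ^+ 2 * rq) by lra.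
have fin x y : - (c * d ^+ 3) * (r1 * x + r2 * y) =
  3 * ((p1 * x + p2 * y) * B' - (q1 * x + q2 * y) * G).
  rewrite mulrBr !(mulrCA 3) GE BE /d /rp /rq; ring.
by rewrite -/G -/B'; congr (_, _, _); rewrite fin.
Qed.

Lemma third_point_chord P Q : on_cubic mq P -> on_cubic mq Q ->
    third_point P Q != 0 -> chord P Q != 0 ->
  proportional (third_point P Q) (opp_pt (chord P Q)).
Proof.
case: P Q => [[u1 v1] w1] [[u2 v2] w2].
rewrite /on_cubic /=; move: mq => k E1 E2.
have {}E1 : u1 ^+ 3 = k * w1 ^+ 3 - v1 ^+ 3 by rewrite -E1 addrK.
have {}E2 : u2 ^+ 3 = k * w2 ^+ 3 - v2 ^+ 3 by rewrite -E2 addrK.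
move=> n0 n1; apply: proportional_cross => //=.
- by apply: contra_neq n1 => -[e1 e2 e3]; congr (_, _, _).
- by ring: E1 E2.
- by ring: E1 E2.
- by ring: E1 E2.
Qed.

End LineSections.

(** * Tangent lines, lines through the identity, and sums *)

Section Tangents.
Variable m : int.
Hypothesis m_neq0 : m != 0.
Let mq : rat := m%:~R.
Let mq0 : mq != 0. Proof. by rewrite intr_eq0. Qed.

(** If X lies on the tangent at P, then F(s P + t X) = t^2 (b s + f t), whose simple root is (s, t)
    = (f, - b). *)
Definition tangent_third (P X : rat * rat * rat) : rat * rat * rat :=
  let: (u, v, w) := P in let: (x, y, z) := X in
  let b := 3 * (u * x ^+ 2 + v * y ^+ 2 - mq * w * z ^+ 2) in
  let f := x ^+ 3 + y ^+ 3 - mq * z ^+ 3 in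
  (u * f - x * b, v * f - y * b, w * f - z * b).

(** Proportional P and Q make p a double root, so the coefficient of s^2 t vanishes, which is the
    tangency equation. The point e is arbitrary because P alone does not determine the line; its
    choice is left to the applications. *)
Lemma line_section_tangential P Q S : line_section m P Q S ->
    proportional (row_triple P) (row_triple Q) ->
  exists A B p, [/\ row_triple P = combine A B p, p != 0,
    forall x, combine A B x = 0 -> x = 0
    & forall e, bracket2 p e != 0 ->
      (row_triple P).1.1 ^+ 2 * (combine A B e).1.1
        + (row_triple P).1.2 ^+ 2 * (combine A B e).1.2
        = mq * (row_triple P).2 ^+ 2 * (combine A B e).2 /\
      proportional (row_triple S) (tangent_third (row_triple P) (combine A B
        e))].
Proof.
move=> ls; have [[/on_cubic_cubic3 cP _ _] _] := line_section_cubic ls.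
case/line_section_combine: ls cP.
move=> A [B [p [q [r [c [[-> -> ->] [p0 q0 r0 c0] I H]]]]]] cP.
move=> [a [b [a0 b0 E]]]; exists A, B, p; split=> // e.
have pq : (a * p.1, a * p.2) = (b * q.1, b * q.2).
  suff [/subr0_eq-> /subr0_eq->] :
    (a * p.1 - b * q.1, a * p.2 - b * q.2) = (0, 0) by [].
  apply: I; case: E => E1 E2 E3; rewrite /combine /=; congr (_, _, _).
  - transitivity (a * (p.1 * A.1.1 + p.2 * B.1.1)
      - b * (q.1 * A.1.1 + q.2 * B.1.1)); first by ring.
    by rewrite E1 subrr.
  - transitivity (a * (p.1 * A.1.2 + p.2 * B.1.2)
      - b * (q.1 * A.1.2 + q.2 * B.1.2)); first by ring.
    by rewrite E2 subrr.
  - transitivity (a * (p.1 * A.2 + p.2 * B.2)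
      - b * (q.1 * A.2 + q.2 * B.2)); first by ring.
    by rewrite E3 subrr.
have H0 := H e; have H1 := H (p.1 + e.1, p.2 + e.2).
have H2 := H (p.1 - e.1, p.2 - e.2).
case: pq => pq1 pq2; move: cP H0 H1 H2 pq1 pq2.
rewrite /proportional /tangent_third /scale /combine /cubic3 /bracket2 /=.
case: p q r A B e {I H E p0 q0 r0} => [p1 p2] [q1 q2] [r1 r2].
move=> [[a1 a2] a3] [[b1 b2] b3] [e1 e2] /=.
set P1 := p1 * a1 + _; set P2 := p1 * a2 + _; set P3 := p1 * a3 + _.
set X1 := e1 * a1 + _; set X2 := e1 * a2 + _; set X3 := e1 * a3 + _ => cP.
have -> : (p1 + e1) * a1 + (p2 + e2) * b1 = P1 + X1 by rewrite /P1 /X1; ring.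
have -> : (p1 + e1) * a2 + (p2 + e2) * b2 = P2 + X2 by rewrite /P2 /X2; ring.
have -> : (p1 + e1) * a3 + (p2 + e2) * b3 = P3 + X3 by rewrite /P3 /X3; ring.
have -> : (p1 - e1) * a1 + (p2 - e2) * b1 = P1 - X1 by rewrite /P1 /X1; ring.
have -> : (p1 - e1) * a2 + (p2 - e2) * b2 = P2 - X2 by rewrite /P2 /X2; ring.
have -> : (p1 - e1) * a3 + (p2 - e2) * b3 = P3 - X3 by rewrite /P3 /X3; ring.
set d := p1 * e2 - p2 * e1; set re := r1 * e2 - r2 * e1.
pose rp := r1 * p2 - r2 * p1.
move=> H0 H1 H2 pq1 pq2 d0.
pose G := P1 ^+ 2 * X1 + P2 ^+ 2 * X2 - mq * P3 ^+ 2 * X3.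
pose B' := P1 * X1 ^+ 2 + P2 * X2 ^+ 2 - mq * P3 * X3 ^+ 2.
pose F := X1 ^+ 3 + X2 ^+ 3 - mq * X3 ^+ 3.
pose k := c * a * d ^+ 2.
have bq x y : b * (q1 * y - q2 * x) = a * (p1 * y - p2 * x).
  by rewrite mulrBr !mulrA -pq1 -pq2 -!mulrA -mulrBr.
have K0 : b * F = k * re.
  rewrite /F H0 /k -/d.
  transitivity (c * (d * (b * (q1 * e2 - q2 * e1)) * re)); first by ring.
  by rewrite bq -/d; ring.
have K1 : b * (3 * G + 3 * B' + F) = k * (rp + re).
  transitivity (b * ((P1 + X1) ^+ 3 + (P2 + X2) ^+ 3 - mq * (P3 + X3) ^+ 3
    - (P1 ^+ 3 + P2 ^+ 3 - mq * P3 ^+ 3))).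
    by rewrite /G /B' /F; ring.
  rewrite cP H1 subr0.
  transitivity (c * ((p1 * (p2 + e2) - p2 * (p1 + e1)) *
    (b * (q1 * (p2 + e2) - q2 * (p1 + e1))) *
     (r1 * (p2 + e2) - r2 * (p1 + e1)))); first by ring.
  by rewrite bq /k /d /rp /re; ring.
have K2 : b * (- (3 * G) + 3 * B' - F) = k * (rp - re).
  transitivity (b * ((P1 - X1) ^+ 3 + (P2 - X2) ^+ 3 - mq * (P3 - X3) ^+ 3
    - (P1 ^+ 3 + P2 ^+ 3 - mq * P3 ^+ 3))).
    by rewrite /G /B' /F; ring.
  rewrite cP H2 subr0.
  transitivity (c * ((p1 * (p2 - e2) - p2 * (p1 - e1)) *
    (b * (q1 * (p2 - e2) - q2 * (p1 - e1))) *
     (r1 * (p2 - e2) - r2 * (p1 - e1)))); first by ring.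
  by rewrite bq /k /d /rp /re; ring.
have bG : b * G = 0 by lra.
have bB : b * (3 * B') = k * rp by lra.
split.
  by apply/subr0_eq/eqP; move/eqP: bG; rewrite mulf_eq0 (negPf b0).
exists (k * d), b; split=> //; first by rewrite /k !mulf_neq0 ?expf_neq0.
have fin x y : k * d * (r1 * x + r2 * y) =
  b * ((p1 * x + p2 * y) * F - (e1 * x + e2 * y) * (3 * B')).
  transitivity ((p1 * x + p2 * y) * (b * F) - (e1 * x + e2 * y) * (b * (3 *
    B'))).
    by rewrite K0 bB /d /rp /re; ring.
  by ring.
by rewrite -/F -/B'; congr (_, _, _); rewrite fin.
Qed.

Lemma exists_bracket2 (p : rat * rat) : p != 0 -> exists e, bracket2 p e != 0.
Proof.
case: p => p1 p2 p0; have [p10|p10] := eqVneq p1 0.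
  exists (1, 0); rewrite /bracket2 /= mulr0 mulr1 sub0r oppr_eq0.
  by apply: contraNneq p0 => ->; rewrite p10.
by exists (0, 1); rewrite /bracket2 /= mulr0 mulr1 subr0.
Qed.

Lemma line_section_tangent P Q S : line_section m P Q S ->
    proportional (row_triple P) (row_triple Q) -> (row_triple P).2 != 0 ->
  proportional (row_triple S) (opp_pt (tangent (row_triple P))).
Proof.
move=> ls pr w0; have [[+ _ _] _] := line_section_cubic ls.
rewrite -/mq.
have [A [B [p [EP p0 I H]]]] := line_section_tangential ls pr.
have [e e0] := exists_bracket2 p0.
(* The auxiliary point is moved along the tangent to where w = 0; tangency then reads u^2 x + v^2 y
   = 0, so (x, y) is a multiple of (v^2, - u^2). *)
pose z := (combine A B e).2.
have w0' : (combine A B p).2 != 0 by rewrite -EP.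
pose e' := ((row_triple P).2 * e.1 - z * p.1, (row_triple P).2 * e.2 - z * p.2).
have e'0 : bracket2 p e' != 0.
  have -> : bracket2 p e' = (row_triple P).2 * bracket2 p e.
    by rewrite /bracket2 /e' /=; ring.
  by rewrite mulf_neq0.
have X0 : combine A B e' != 0.
  apply: contra_neq e'0 => /I ->; by rewrite /bracket2 /= !mulr0 subrr.
have zE : (combine A B e').2 = 0.
  by rewrite /e' EP /z /combine /=; ring.
have := H e' e'0; move: w0; case: (row_triple P) => [[u v] w] w0.
case: (combine A B e') zE X0 => [[x y] z'] /= -> X0 [].
rewrite /on_cubic /= => g pS C; rewrite mulr0 in g.
apply: proportional_trans pS _.
have [k [k0 xE yE]] : exists k, [/\ k != 0, x = v ^+ 2 * k & y = - (u ^+ 2 *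
  k)].
  have [u0|u0] := eqVneq u 0.
    have v0 : v != 0.
      apply: contraNneq w0 => v0; move/esym/eqP: C; rewrite u0 v0 expr0n addr0.
      by rewrite mulf_eq0 (negPf mq0) expf_eq0.
    have /eqP : v ^+ 2 * y = 0 by rewrite -[RHS]g u0; ring.
    rewrite mulf_eq0 expf_eq0 (negPf v0) /=.
    move/eqP => y0; have x0 : x != 0 by apply: contraNneq X0 => ->; rewrite y0.
    exists (x / v ^+ 2); split; first by rewrite mulf_neq0 ?invr_eq0 ?expf_neq0.
      by rewrite mulrC divfK ?expf_neq0.
    by rewrite y0 u0; ring.
  have xy : x = v ^+ 2 * - (y / u ^+ 2).
    apply: (mulfI (expf_neq0 2 u0)); rewrite -[LHS](addrK (v ^+ 2 * y)) g.
    by field.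
  exists (- (y / u ^+ 2)); split=> //.
    apply: contraNneq X0 => k0; rewrite xy k0 mulr0.
    suff -> : y = 0 by [].
    by move/eqP: k0; rewrite oppr_eq0 mulf_eq0 invr_eq0 expf_eq0 (negPf u0)
      orbF => /eqP.
  by field.
exists 1, (- k ^+ 3 * (mq * w ^+ 3)); split.
- exact: oner_neq0.
- by rewrite mulf_neq0 ?oppr_eq0 ?mulf_neq0 ?expf_neq0.
by rewrite -C xE yE /scale /=; congr (_, _, _); ring.
Qed.

(** A line through (-1, 1, 0) is mapped to itself by the swap of u and v. If S is the identity as
    well, the line is the tangent u + v = 0 at a flex, and T is again the identity. *)
Lemma line_section_identity S T : line_section m identity_pt S T ->
  proportional (row_triple T) (opp_pt (row_triple S)).
Proof.
move=> ls; have [[_ cS _] [n1 nS nT]] := line_section_cubic ls.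
have [pr|npr] := proportional_dec n1 nS.
  have [A [B [p [EP p0 I H]]]] := line_section_tangential ls pr.
  have [e e0] := exists_bracket2 p0.
  have pr' := proportional_opp pr.
  apply: proportional_trans pr'; have := H e e0.
  rewrite row_triple_coords; case: (combine A B e) => [[x y] z] /= [g pT].
  have /esym := proportional_eq0 pT; rewrite (negPf nT) => /negbT nz.
  apply: proportional_trans pT _.
  have yx : y = - x.
    rewrite -[y](addrK x) -[RHS]add0r; congr (_ - _).
    transitivity ((-1) ^+ 2 * x + 1 ^+ 2 * y); first by ring.
    by rewrite g; ring.
  move: nz; rewrite /= yx => nz.
  by apply: proportional_cross nz _ _ _ _ => //=; ring.
have pT := line_section_third ls npr.
have /esym := proportional_eq0 pT; rewrite (negPf nT) => /negbT nz.
apply: proportional_trans pT _; move: nz nS {npr ls n1 nT cS}.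
rewrite row_triple_coords; case: (row_triple S) => [[u v] w] nz nS.
apply: proportional_cross nz _ _ _ _ => /=.
- by apply: contra_neq nS => -[e1 e2 e3]; congr (_, _, _).
- by ring.
- by ring.
- by ring.
Qed.

Lemma is_sum_chord P Q T : is_sum m P Q T ->
    (row_triple P).2 != 0 -> (row_triple Q).2 != 0 ->
    ~ proportional (row_triple P) (row_triple Q) ->
  proportional (row_triple T) (chord (row_triple P) (row_triple Q)).
Proof.
case=> S lS lT wP wQ npr; have [[cP cQ cS] [_ _ nS]] := line_section_cubic lS.
apply: proportional_trans (line_section_identity lT) _.
rewrite -[chord _ _]opp_ptK; apply: proportional_opp.
have pS := line_section_third lS npr.
apply: (proportional_trans pS); apply: (third_point_chord cP cQ).
  by rewrite -(proportional_eq0 pS).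
exact: (chord_neq0 cP cQ wP wQ mq0 npr).
Qed.

Lemma is_sum_tangent P Q T : is_sum m P Q T -> (row_triple P).2 != 0 ->
    proportional (row_triple P) (row_triple Q) ->
  proportional (row_triple T) (tangent (row_triple P)).
Proof.
case=> S lS lT wP pr.
apply: proportional_trans (line_section_identity lT) _.
rewrite -[tangent _]opp_ptK; apply: proportional_opp.
exact: line_section_tangent lS pr wP.
Qed.

Lemma is_sum_on_cubic P Q T : is_sum m P Q T ->
  on_cubic mq (row_triple T) /\ row_triple T != 0.
Proof. by case=> S _ /line_section_cubic[[_ _ ?] [_ _ ?]]. Qed.

(** Over [rat], u^3 = - v^3 forces u = - v. *)
Lemma on_cubic_w0_identity (X : rat * rat * rat) : on_cubic mq X -> X != 0 ->
  X.2 = 0 -> proportional X (row_triple identity_pt).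
Proof.
rewrite row_triple_coords; case: X => [[u v] w] /= C X0 w0.
have uv : u = - v.
  apply: expr3_inj; rewrite -[LHS](addrK (v ^+ 3)) C /= w0.
  by ring.
have v0 : v != 0 by apply: contraNneq X0 => v0; rewrite uv v0 w0 oppr0.
exists 1, v; rewrite oner_neq0 v0; split=> //.
by rewrite /scale /= uv w0; congr (_, _, _); ring.
Qed.

(** [is_multiple] speaks of vectors and [torsion] of the particular vector [identity_pt]. Rescaling
    representatives, with c adjusted to compensate, closes the gap. *)
Lemma line_section_scale P Q S a : a != 0 ->
  line_section m P Q S -> line_section m P Q (a *: S).
Proof.
move=> a0 [L [p [q [r [c [fL [p0 q0 r0 c0] [-> -> ->] H]]]]]].
exists L, p, q, (a *: r), (c / a); split=> //.
- by split=> //; rewrite ?scaler_eq0 ?(negPf a0) // mulf_neq0 ?invr_eq0.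
- by rewrite scalemxAl.
- by move=> x; rewrite H /bracket !mxE; field.
Qed.

Lemma line_section_scalel P Q S a : a != 0 ->
  line_section m P Q S -> line_section m (a *: P) Q S.
Proof.
move=> a0 [L [p [q [r [c [fL [p0 q0 r0 c0] [-> -> ->] H]]]]]].
exists L, (a *: p), q, r, (c / a); split=> //.
- by split=> //; rewrite ?scaler_eq0 ?(negPf a0) // mulf_neq0 ?invr_eq0.
- by rewrite scalemxAl.
- by move=> x; rewrite H /bracket !mxE; field.
Qed.

Lemma is_multiple_scale (X : 'rV[rat]_3) n P a : (0 < n)%N -> a != 0 ->
  is_multiple m X n P -> is_multiple m X n (a *: P).
Proof.
case: n => // n _ a0 [Q mQ [S lS lT]]; exists Q => //; exists S => //.
exact: line_section_scale.
Qed.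

(** * Multiples of a non-torsion point, up to proportionality *)

Section NonTorsion.
Variable X : 'rV[rat]_3.
Hypothesis X_on_curve : on_curve m X.
Hypothesis X_non_torsion : ~ torsion m X.

Lemma is_multiple_on_cubic n P : (0 < n)%N -> is_multiple m X n P ->
  on_cubic mq (row_triple P) /\ row_triple P != 0.
Proof. by case: n => // n _ [Q _ /is_sum_on_cubic]. Qed.

Lemma is_multiple_w_neq0 n P : (0 < n)%N -> is_multiple m X n P ->
  (row_triple P).2 != 0.
Proof.
move=> n0 mP; apply/eqP => w0; apply: X_non_torsion; exists n => //.
have [cP nP] := is_multiple_on_cubic n0 mP.
have [a a0 ->] := proportional_row (on_cubic_w0_identity cP nP w0).
exact: is_multiple_scale.
Qed.

Let X_cubic : on_cubic mq (row_triple X) /\ row_triple X != 0.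
Proof.
case: X_on_curve => X0 cX; rewrite row_triple_eq0; split=> //.
by apply/on_cubic_cubic3; rewrite -cX.
Qed.

Lemma is_multiple1 P : is_multiple m X 1 P ->
  proportional (row_triple P) (row_triple X).
Proof.
move=> mP; have wP := is_multiple_w_neq0 (ltnSn 0) mP.
case: mP => Q /= QI [S lS lT]; have [cX nX] := X_cubic.
have [_ [nQ _ _]] := line_section_cubic lS.
have {}QI : proportional (row_triple Q) (row_triple identity_pt).
  by apply: eqmx_row_proportional QI; rewrite -row_triple_eq0.
have [a a0 E] := proportional_row QI.
have := line_section_scalel a0 lS; rewrite -E => /line_section_identity pS.
apply: proportional_trans (line_section_identity lT) _.
by rewrite -[row_triple X]opp_ptK; apply: proportional_opp.
Qed.

Hypothesis X_w : (row_triple X).2 != 0.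

(** [is_multiple] hides an intermediate vector that need not be the prescribed one. Any two choices
    agree up to a factor, because the chord and tangent formulas respect proportionality. *)
Lemma is_multiple_unique n P P' : (0 < n)%N ->
    is_multiple m X n P -> is_multiple m X n P' ->
  proportional (row_triple P) (row_triple P').
Proof.
elim: n P P' => // -[|n] IHn P P' _ mP mP'.
  apply: proportional_trans (is_multiple1 mP) _.
  exact/proportional_sym/is_multiple1.
case: mP mP' => [Q mQ sP] [Q' mQ' sP'].
have [cQ nQ] := is_multiple_on_cubic (ltn0Sn n) mQ.
have wQ := is_multiple_w_neq0 (ltn0Sn n) mQ.
have wQ' := is_multiple_w_neq0 (ltn0Sn n) mQ'.
have QQ' := IHn Q Q' isT mQ mQ'.
have [pr|npr] := proportional_dec nQ (proj2 X_cubic).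
  apply: proportional_trans (is_sum_tangent sP wQ pr) _.
  apply: proportional_sym.
  apply: proportional_trans (is_sum_tangent sP' wQ' _) _.
    by apply: proportional_trans pr; apply: proportional_sym.
  exact/proportional_tangent/proportional_sym.
apply: proportional_trans (is_sum_chord sP wQ X_w npr) _.
apply: proportional_sym.
apply: proportional_trans (is_sum_chord sP' wQ' X_w _) _.
  by move=> pr; apply: npr; apply: proportional_trans pr.
by apply: proportional_chord; [apply: proportional_sym | apply:
  proportional_refl].
Qed.

Lemma is_multiple_step n P P1 P' : (0 < n)%N ->
    is_multiple m X n P -> is_multiple m X 1 P1 -> is_multiple m X n.+1 P' ->
  (proportional (row_triple P) (row_triple P1) ->
     proportional (row_triple P') (tangent (row_triple P1))) /\
  (~ proportional (row_triple P) (row_triple P1) ->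
     proportional (row_triple P') (chord (row_triple P) (row_triple P1))).
Proof.
move=> n0 mP mP1 [Q mQ sP']; have p1X := is_multiple1 mP1.
have QP := is_multiple_unique n0 mQ mP; have wQ := is_multiple_w_neq0 n0 mQ.
split=> [pr|npr].
  have pQ := proportional_trans QP pr.
  apply: proportional_trans (is_sum_tangent sP' wQ _) (proportional_tangent pQ).
  exact: proportional_trans pQ p1X.
apply: proportional_trans (is_sum_chord sP' wQ X_w _) _.
  move=> pr; apply: npr; apply: proportional_trans (proportional_sym QP) _.
  exact: proportional_trans pr (proportional_sym p1X).
by apply: proportional_chord; last exact: proportional_sym.
Qed.

End NonTorsion.

End Tangents.

(** * From rational vectors to primitive integral coordinates *)

Definition int_triple (P : int * int * int) : rat * rat * rat :=
  (P.1.1%:~R, P.1.2%:~R, P.2%:~R).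

Lemma int_triple_on_cubic (m : int) P :
  on_cubic m%:~R (int_triple P) <-> on_cubic m P.
Proof.
rewrite /on_cubic /= -!rmorphXn -rmorphD -rmorphM.
by split=> [/eqP|->//]; rewrite eqr_int => /eqP.
Qed.

Lemma int_triple_chord P Q :
  chord (int_triple P) (int_triple Q) = int_triple (chord P Q).
Proof.
case: P Q => [[u1 v1] w1] [[u2 v2] w2]; rewrite /int_triple /chord /=.
by rewrite !(rmorphB, rmorphM, rmorphXn).
Qed.

Lemma int_triple_tangent P : tangent (int_triple P) = int_triple (tangent P).
Proof.
case: P => [[u v] w]; rewrite /int_triple /tangent /=.
by rewrite !(rmorphB, rmorphD, rmorphM, rmorphN, rmorphXn).
Qed.

Lemma int_triple_scale a P : int_triple (scale a P) = scale a%:~R (int_triple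
  P).
Proof. by rewrite /int_triple /scale /= !rmorphM. Qed.

Lemma int_triple_proportional P Q : P != 0 -> Q != 0 ->
  proportional (int_triple P) (int_triple Q) <-> proportional P Q.
Proof.
move=> P0 Q0; split=> [/cross_proportional[/= E1 E2 E3]|[a [b [a0 b0 E]]]].
  by apply: proportional_cross => //; apply: (@intr_inj rat); rewrite !rmorphM.
exists a%:~R, b%:~R; rewrite !intr_eq0; split=> //.
by rewrite -!int_triple_scale E.
Qed.

(** A prime dividing u and v does not divide w, so its cube would divide m. *)
Lemma cube_free_coprime (m u v w : int) : cube_free m ->
  u ^+ 3 + v ^+ 3 = m * w ^+ 3 -> gcdz (gcdz u v) w = 1 -> coprimez u v.
Proof.
move=> cf E g1; apply/negPn/negP; rewrite coprimezE /coprime => g.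
have [p pp pg] : exists2 p, prime p & (p %| gcdn `|u| `|v|)%N.
  (* A zero gcd is divisible by every prime, so 2 serves as a default. *)
  have [g0|g0] := posnP (gcdn `|u| `|v|); first by exists 2%N; rewrite ?g0.
  exists (pdiv (gcdn `|u| `|v|)); last exact: pdiv_dvd.
  by rewrite pdiv_prime // ltn_neqAle eq_sym g g0.
move: (pg); rewrite dvdn_gcd => /andP[pu pv].
have pw : ~~ (p %| `|w|)%N.
  apply/negP => pw; have : (p%:Z %| gcdz (gcdz u v) w)%Z.
    by rewrite !dvdz_gcd !dvdzE pu pv pw.
  by rewrite g1 dvdz1 /= => /eqP p1; move: pp; rewrite p1.
have := cf p pp; apply/negP/negPn.
have : (p%:Z ^+ 3 %| m * w ^+ 3)%Z by rewrite -E rpredD // dvdz_exp2r.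
rewrite Gauss_dvdzl ?dvdzE ?abszX //.
by rewrite coprimezXl // coprimezXr // coprimezE prime_coprime.
Qed.

Theorem theorem1p1 (m : int) (m_neq0 : m != 0) (m_cube_free : cube_free m)
    (R : 'rV[rat]_3) (R_on_curve : on_curve m R) (R_non_torsion : ~ torsion m R)
    (U V W : nat -> int)
    (UVW_multiple : forall n : nat, (1 <= n)%N ->
       is_multiple m R n (coords (U n)%:~R (V n)%:~R (W n)%:~R))
    (UVW_lowest : forall n : nat, (1 <= n)%N ->
       gcdz (gcdz (U n) (V n)) (W n) = 1) :
  forall n : nat, (1 < n)%N -> exists d : int, primitive_divisor W n d.
Proof.
pose t n := (U n, V n, W n).
have tE n : row_triple (coords (U n)%:~R (V n)%:~R (W n)%:~R) = int_triple (t
  n).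
  exact: row_triple_coords.
have t_cubic n : (0 < n)%N -> on_cubic m (t n).
  move=> n0; apply/int_triple_on_cubic; rewrite -tE.
  by case: (is_multiple_on_cubic n0 (UVW_multiple n n0)).
have t_w n : (0 < n)%N -> (t n).2 != 0.
  move=> n0; have := is_multiple_w_neq0 R_non_torsion n0 (UVW_multiple n n0).
  by rewrite tE intr_eq0.
have t_nz n : (0 < n)%N -> t n != 0 by move=> n0; apply/w_neq0_neq0/t_w.
have t_coprime n : (0 < n)%N -> coprimez (t n).1.1 (t n).1.2.
  move=> n0; apply: cube_free_coprime m_cube_free (t_cubic n n0) _.
  exact: UVW_lowest.
have R_w : (row_triple R).2 != 0.
  have := is_multiple1 R_on_curve R_non_torsion (UVW_multiple 1%N isT).
  move/proportional_w_eq0; rewrite tE intr_eq0 => <-; exact: t_w.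
have step n (n0 : (0 < n)%N) := is_multiple_step m_neq0 R_on_curve R_non_torsion
  R_w n0 (UVW_multiple n n0) (UVW_multiple 1%N isT) (UVW_multiple n.+1 isT).
have t_chord n : (0 < n)%N -> ~ proportional (t n) (t 1%N) ->
    proportional (t n.+1) (chord (t n) (t 1%N)).
  move=> n0 npr; apply/int_triple_proportional; rewrite ?t_nz //.
    exact: chord_neq0 (t_cubic n n0) (t_cubic 1%N isT) (t_w n n0) (t_w 1%N isT)
      m_neq0 npr.
  rewrite -int_triple_chord -!tE; apply: (proj2 (step n n0)).
  by rewrite !tE => /int_triple_proportional pr; apply/npr/pr; rewrite t_nz.
have t_tangent n : (0 < n)%N -> proportional (t n) (t 1%N) ->
    proportional (t n.+1) (tangent (t 1%N)).
  move=> n0 pr; apply/int_triple_proportional; rewrite ?t_nz //.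
    exact: tangent_neq0 (t_cubic 1%N isT) (t_w 1%N isT) m_neq0.
  rewrite -int_triple_tangent -!tE; apply: (proj1 (step n n0)).
  by rewrite !tE; apply/int_triple_proportional; rewrite ?t_nz.
have t_double n : (0 < n)%N ->
    exists c : int, (c %| 3)%Z /\ tangent (t n) = scale c (t (n + n)%N).
  move=> n0; have nn : (0 < n + n)%N by rewrite addn_gt0 n0.
  have := multiple_double m_neq0 t_w t_cubic t_chord t_tangent n0.
  move=> /proportional_sym/proportional_primitive/(_ (t_coprime _ nn))[c E].
  by exists c; split=> //; apply: tangent_factor E; apply: t_coprime.
(* The conclusion is purely integral; a concrete model of the reals is supplied only for the
   logarithms used on the way. *)
apply: (primitive_divisors (t := t) t_cubic t_coprime t_w t_double _ m_neq0 _ _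
  Rdefinitions.R).
- move=> a b b0 ba; have a0 : (0 < a)%N by apply: ltn_trans ba.
  have s0 : (0 < a + b)%N by rewrite addn_gt0 a0.
  have d0 : (0 < a - b)%N by rewrite subn_gt0.
  apply: sum_difference_factor (t_cubic a a0) (t_cubic b b0) (t_w _ d0)
    (t_w _ s0) _ _ (t_coprime _ d0) (t_coprime _ s0).
    exact: (multipleB m_neq0 t_w t_cubic t_chord t_tangent).
  exact: (multipleD m_neq0 t_w t_cubic t_chord t_tangent).
- exact: (multiple_uv_neq0 m_neq0 t_w t_cubic t_chord t_tangent).
- exact: (multiple_neq_uv m_neq0 t_w t_cubic t_chord t_tangent).
Qed.
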